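(* Let $\mu\in\mathcal{M}^*$ and suppose $\{v_1,\ldots,v_n\}$ is a basis of $\mathbb{R}^n$. For $j=1,\ldots,n$ and $m=0,1,2,\ldots$ define $$s_j(m)=\int_{\mathbb{R}^n} (v_j,x)^m\,d\mu(x).$$ If each of the sequences $\{s_j(m)\}_{m=1}^\infty$ ($j=1,\ldots,n$) satisfies Carleman's condition $$\sum_{m=1}^\infty\frac{1}{s_j(2m)^{1/(2m)}}=\infty,$$ then $\mu$ is determinate. Furthermore, the polynomials, and also $\operatorname{Span}_{\mathbb{C}}\{e_{i\lambda}\mid\lambda\in S\}$ for every subset $S$ of $\mathbb{R}^n$ which is somewhere dense, are then dense in $L_p(\mathbb{R}^n,\mu)$ for all $1\leq p<\infty$.
   Context: $(\cdot,\cdot)$ is the standard inner product on $\mathbb{R}^n$ with norm $\Vert\cdot\Vert$. For $\lambda\in\mathbb{R}^n$, $e_{i\lambda}:\mathbb{R}^n\to\mathbb{C}$ is $e_{i\lambda}(x)=\exp(i(\lambda,x))$. A subset $S\subset\mathbb{R}^n$ is somewhere dense if its closure has non-empty interior. $\mathcal{M}^*$ is the set of all positive Borel measures $\mu$ on $\mathbb{R}^n$ such that $\int_{\mathbb{R}^n}\Vert x\Vert^d\,d\mu(x)<\infty$ for all $d\ge 0$. A measure $\mu$ is determinate if $\mu\in\mathcal{M}^*$ and $\mu$ is uniquely determined in $\mathcal{M}^*$ by the integrals $\int_{\mathbb{R}^n}P\,d\mu$ of all polynomials $P$ on $\mathbb{R}^n$ (i.e. any $\nu\in\mathcal{M}^*$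 with the same integrals of all polynomials equals $\mu$). In the series, $1/0$ is read as $+\infty$. $L_p$-spaces consist of complex-valued functions and polynomials have complex coefficients. *)

(* Defs.v *)
From HB Require Import structures.
From mathcomp Require Import all_boot all_order all_algebra.
From mathcomp Require Import all_classical all_reals all_analysis.
From mathcomp Require Import complex.
(* Not imported: the notations of mpoly clash with those of mathcomp-analysis. *)
From mathcomp Require mpoly.

Set Implicit Arguments.
Unset Strict Implicit.
Unset Printing Implicit Defensive.

Import Order.TTheory GRing.Theory Num.Theory.
Import numFieldTopology.Exports numFieldNormedType.Exports.

Local Open Scope classical_set_scope.
Local Open Scope ring_scope.
Local Open Scope complex_scope.

(* R^n with its Borel sigma-algebra. The topology of 'rV[R]_n is the product
   topology (it comes from the sup norm), i.e. the Euclidean one. *)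
Notation borelRn R n := (g_sigma_algebraType (@open 'rV[R]_n)).

Section EuclideanSpace.
Context {R : realType} {n : nat}.

Definition inner (u v : 'rV[R]_n) : R := \sum_(j < n) u ord0 j * v ord0 j.

(* The library norm `|x| on 'rV[R]_n is the sup norm. *)
Definition enorm (x : 'rV[R]_n) : R := Num.sqrt (inner x x).

Definition somewhere_dense (S : set 'rV[R]_n) : Prop :=
  interior (closure S) !=set0.

End EuclideanSpace.

Section ComplexFunctions.
Context {R : realType}.

Definition cexp (z : R[i]) : R[i] :=
  (expR (complex.Re z))%:C * (cos (complex.Im z) +i* sin (complex.Im z)).

Definition cspan (T : Type) (F : set (T -> R[i])) : set (T -> R[i]) :=
  [set f | exists (k : nat) (c : 'I_k -> R[i]) (g : 'I_k -> T -> R[i]),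
    (forall i, F (g i)) /\ f = (fun x => \sum_(i < k) c i * g i x)].

Section Integration.
Context {d : measure_display} {T : measurableType d}.
Variable mu : {measure set T -> \bar R}.

Definition cmeasurable (f : T -> R[i]) : Prop :=
  measurable_fun setT (fun x => complex.Re (f x)) /\
  measurable_fun setT (fun x => complex.Im (f x)).

Definition cintegral (f : T -> R[i]) : R[i] :=
  (\int[mu]_x complex.Re (f x)) +i* (\int[mu]_x complex.Im (f x)).

Definition cLnorm (p : R) (f : T -> R[i]) : \bar R :=
  Lnorm mu p%:E (fun x => (Normc.normc (f x))%:E).

(* Members of L_p are represented by functions rather than by classes modulo
   almost everywhere equality, on which cLnorm is only a seminorm. *)
Definition Lp (p : R) : set (T -> R[i]) :=
  [set f | cmeasurable f /\ (cLnorm p f < +oo)%E].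

Definition dense_in_Lp (p : R) (F : set (T -> R[i])) : Prop :=
  F `<=` Lp p /\
  forall f, Lp p f -> forall e : R, 0 < e ->
    exists2 g, F g & (cLnorm p (fun x => (f x - g x)%R) < e%:E)%E.

End Integration.
End ComplexFunctions.

Section MomentProblem.
Context {R : realType} {n : nat}.

Definition expi (l : 'rV[R]_n) : borelRn R n -> R[i] :=
  fun x => cexp ('i%C * (inner l x)%:C).

Definition poly_fun (P : mpoly.mpoly n R[i]) : borelRn R n -> R[i] :=
  fun x => mpoly.meval (fun j => ((x : 'rV[R]_n) ord0 j)%:C) P.

Definition Mstar (mu : {measure set (borelRn R n) -> \bar R}) : Prop :=
  forall d : R, 0 <= d -> (\int[mu]_x (enorm x `^ d)%:E < +oo)%E.

(* Equality of measures is equality on Borel sets: their values on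
   non-measurable sets are irrelevant. *)
Definition determinate (mu : {measure set (borelRn R n) -> \bar R}) : Prop :=
  Mstar mu /\
  forall nu : {measure set (borelRn R n) -> \bar R}, Mstar nu ->
    (forall P : mpoly.mpoly n R[i],
       cintegral nu (poly_fun P) = cintegral mu (poly_fun P)) ->
    forall A : set (borelRn R n), measurable A -> nu A = mu A.

Definition moment (mu : {measure set (borelRn R n) -> \bar R})
    (v : 'rV[R]_n) (m : nat) : R :=
  \int[mu]_x (inner v x ^+ m).

End MomentProblem.

(* The inverse is taken in \bar R, where 0^-1 = +oo. *)
Definition carleman {R : realType} (s : nat -> R) : Prop :=
  (\sum_(1 <= m <oo) ((s (2 * m)%N `^ (2 * m)%:R^-1)%:E)^-1 = +oo)%E.

(* Main.v *)
Require Import Defs.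
From HB Require Import structures.
From mathcomp Require Import all_boot all_order all_algebra.
From mathcomp Require Import all_classical all_reals all_analysis.
From mathcomp Require Import measurable_realfun complex.
From mathcomp Require mpoly.
From mathcomp Require Import ring lra zify.

Set Implicit Arguments.
Unset Strict Implicit.
Unset Printing Implicit Defensive.

Import Order.TTheory GRing.Theory Num.Theory.
Import numFieldTopology.Exports numFieldNormedType.Exports.
Import HBSimple HBNNSimple.
(* The algebraic structures on mpoly, without its notations. *)
Import (canonicals, coercions) mpoly.

(* Let V be a subspace of L_p(mu) and put F_j(t) = y^j e^{ity} f with
   y = (v, x). If y satisfies Carleman's condition and all F_j(0) lie in the
   closure of V, then so do all F_j(t): Taylor's formula bounds the distance from
   F_j(t + h) to V by the distances from the F_{j+k}(t) to V, and Bang's proof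
   of the Denjoy-Carleman theorem uses nothing but such bounds (and the
   log-convexity of the moments), hence applies to distances instead of absolute
   values. Applying this successively along v_1, ..., v_n shows that the closure
   of V contains every exponential as soon as it contains all P e_{i l0}, P a
   polynomial. For V the polynomials one takes l0 = 0; for the span of
   e_{i l}, l in S, one takes l0 in the interior of the closure of S and
   differentiates at l0.

   The trigonometric polynomials are dense in L_p(mu): the bounded functions in
   their closure form an algebra closed under bounded pointwise limits, which
   contains the functions sgn(x_j - a), hence the indicators of all Borel sets.

   If nu has the same moments as mu, then mu + nu also satisfies Carleman's
   condition, so the indicator of a Borel set is approximated by polynomials in
   L_1(mu + nu), and mu and nu agree on it. *)

Local Open Scope classical_set_scope.
Local Open Scope ring_scope.

(** * Quasi-analyticity and Carleman sequences *)

(** The distance to V takes the place of the functionals in the dual of L_p that vanish on V. Bang's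
    argument asks for bounds M_n = m_0 ... m_(n-1) with m increasing and the sum of the 1/m_i
    infinite, whereas Carleman's condition speaks of roots of moments; Carleman's inequality on
    geometric means is the bridge between the two. Besides y^j, F_j(t) contains the factor f, so its
    L_k norm is split by Hoelder's inequality into two L_{2k} norms. For an integer k, the 2k-th
    power of the norm of y^j is the even moment of order 2kj. Its bound is a product over kj
    indices; grouping them in blocks of k amounts to sampling m at the multiples of k, which keeps
    the sum of the 1/m_i infinite. A real p is reached from an integer k > p because mu is
    finite. *)

Lemma sum_half_le2 (R : realType) (K : nat) :
  \sum_(k < K) (2^-1 : R) ^+ k <= 2.
Proof.
suff -> : \sum_(k < K) (2^-1 : R) ^+ k = 2 - 2 * 2^-1 ^+ K.
  by rewrite lerBlDr lerDl mulr_ge0// exprn_ge0// invr_ge0.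
elim: K => [|K IH]; first by rewrite big_ord0 expr0; lra.
rewrite big_ord_recr/= IH exprS; lra.
Qed.

(** Read [D n t c] as: the n-th derivative at t has size at most c. With M_n the product of the
    first n [m i], level N at t means that these sizes are at most C 2^(n-N) M_n for all n. A move
    of length 1/(4 m_N) costs one level, and the lengths of the moves have an infinite sum. Since
    every level holds at 0, every level holds at every t. *)
Lemma bang (R : realType) (m : nat -> R) (C : R) (D : nat -> R -> R -> Prop) :
  (forall i, 0 < m i) -> {homo m : i j / (i <= j)%N >-> i <= j} ->
  (forall A, exists L, A <= \sum_(i < L) (m i)^-1) ->
  0 <= C ->
  (forall n t c c', c <= c' -> D n t c -> D n t c') ->
  (forall n t, D n t (C * \prod_(i < n) m i)) ->
  (forall n, D n 0 0) ->
  (forall n t h K (c : nat -> R), (forall k, (k < K)%N -> D (n + k)%N t (c k)) ->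
    D n (t + h) (\sum_(k < K) `|h| ^+ k * c k +
                 `|h| ^+ K * (C * \prod_(i < n + K) m i))) ->
  forall n t e, 0 < e -> D n t e.
Proof.
move=> m0 mnd mdiv C0 Dle DM D0 DT.
pose M n := \prod_(i < n) m i.
have M0 n : 0 <= M n by apply: prodr_ge0 => i _; exact: ltW.
have MS n k N : (n + k <= N.+1)%N -> M (n + k)%N <= M n * m N ^+ k.
  elim: k => [|k IH] h; first by rewrite addn0 expr0 mulr1.
  rewrite /M addnS big_ord_recr/= exprSr mulrA ler_pM//.
  - exact: M0.
  - exact: ltW.
  - by apply: IH; lia.
  - by apply: mnd; lia.
pose beta N t := forall n, D n t (C * (2 ^+ n / 2 ^+ N) * M n).
have step N t h : beta N.+1 t -> `|h| <= (4 * m N)^-1 -> beta N (t + h).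
  move=> bt hh n.
  have [Nn|nN] := leqP N n.
    (* Here 2^(n-N) is at least 1, so the a priori bound is enough. *)
    apply: Dle (DM n _); rewrite -/(M n) ler_wpM2r// ler_peMr//.
    by rewrite ler_pdivlMr ?exprn_gt0// mul1r ler_eXn2l// ltr1n.
  (* The expansion stops at order N+1, where the bound of level N+1 is the a priori bound itself:
     the remainder becomes the term k = K of the sum. *)
  pose K := (N.+1 - n)%N.
  have nK : (n + K)%N = N.+1 by rewrite /K; lia.
  have := DT n t h K (fun k => C * (2 ^+ (n + k) / 2 ^+ N.+1) * M (n + k)%N)
    (fun k _ => bt _).
  apply: Dle; rewrite -/(M (n + K)%N).
  rewrite (_ : C * M (n + K)%N = C * (2 ^+ (n + K) / 2 ^+ N.+1) * M (n + K)%N); last first.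
    by rewrite nK divff ?mulr1// expf_neq0.
  have E : \sum_(k < K.+1)
    `|h| ^+ k * (C * (2 ^+ (n + k) / 2 ^+ N.+1) * M (n + k)%N) = _ := big_ord_recr _ _.
  rewrite /= in E; rewrite -E.
  (* In the k-th term, m_N^k cancels against [|h| ^+ k], which leaves 4^-k against the weight 2^k.
     The geometric sum is at most 2, and this factor is the level that is lost. *)
  apply: (@le_trans _ _ (\sum_(k < K.+1) C * (2 ^+ n / 2 ^+ N.+1) * M n * 2^-1 ^+ k)).
    apply: ler_sum => k _.
    have kK : (n + k <= N.+1)%N by have := ltn_ord k; lia.
    apply: (@le_trans _ _ (((4 * m N)^-1) ^+ k *
        (C * (2 ^+ (n + k) / 2 ^+ N.+1) * (M n * m N ^+ k)))).
      have c0 : 0 <= C * (2 ^+ (n + k) / 2 ^+ N.+1 : R).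
        by rewrite mulr_ge0// divr_ge0// exprn_ge0.
      apply: ler_pM => //.
      + by rewrite mulr_ge0.
      + by rewrite lerXn2r// nnegrE ?invr_ge0 ?mulr_ge0// ltW.
      + by rewrite ler_wpM2l// MS.
    rewrite le_eqVlt; apply/orP; left; apply/eqP.
    have mN : m N != 0 by rewrite gt_eqF.
    rewrite exprD exprVn exprMn exprVn.
    rewrite (_ : 4 = 2 * 2 :> R); last by lra.
    rewrite exprMn; field.
    by rewrite !expf_neq0//= exprS mulf_neq0// expf_neq0.
  rewrite -mulr_sumr.
  apply: (@le_trans _ _ (C * (2 ^+ n / 2 ^+ N.+1) * M n * 2)).
    by rewrite ler_wpM2l ?sum_half_le2// !mulr_ge0// ?invr_ge0 exprn_ge0.
  rewrite le_eqVlt; apply/orP; left; apply/eqP.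
  by rewrite exprS; field; rewrite expf_neq0.
(* The path starts at 0 with level N+d and spends the lengths 1/(4 m_(N+d-1)), ..., 1/(4 m_N) in
   this order; the induction peels off the last move. *)
have main d : forall N t,
    `|t| <= \sum_(i < d) (4 * m (N + i)%N)^-1 -> beta N t.
  elim: d => [|d IH] N t ht n.
    move: ht; rewrite big_ord0 normr_le0 => /eqP ->.
    by apply: Dle (D0 n); rewrite !mulr_ge0// ?invr_ge0 exprn_ge0.
  move: ht; rewrite big_ord_recl/= addn0.
  under eq_bigr do rewrite /bump/= add1n addnS -addSn.
  move=> ht.
  set a := (4 * m N)^-1 in ht.
  have a0 : 0 < a by rewrite invr_gt0 mulr_gt0.
  have S0 : 0 <= \sum_(i < d) (4 * m (N.+1 + i)%N)^-1.
    by apply: sumr_ge0 => i _; rewrite invr_ge0 mulr_ge0// ltW.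
  have [ta|ta] := leP `|t| a.
    rewrite -[t]add0r; apply: step ta _.
    by apply: IH; rewrite normr0.
  have [t0|t0] := leP 0 t.
    rewrite -(subrK a t); apply: step; last by rewrite gtr0_norm.
    by apply: IH; rewrite (ger0_norm t0) in ht ta; rewrite ger0_norm; lra.
  rewrite -(addrK a t); apply: step; last by rewrite normrN gtr0_norm.
  by apply: IH; rewrite (ltr0_norm t0) in ht ta; rewrite ler0_norm; lra.
have allbeta N t : beta N t.
  have [L hL] := mdiv (4 * `|t| + \sum_(i < N) (m i)^-1).
  apply: (main L) => //.
  have E : 4 * \sum_(i < L) (4 * m (N + i)%N)^-1 = \sum_(i < L) (m (N + i)%N)^-1.
    rewrite mulr_sumr; apply: eq_bigr => i _.
    by field; rewrite gt_eqF.
  have F : \sum_(i < L) (m i)^-1 <= \sum_(i < N) (m i)^-1 + \sum_(i < L) (m (N + i)%N)^-1.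
    have := @big_split_ord _ 0 +%R N L xpredT (fun i : 'I_(N + L) => (m i)^-1).
    rewrite /= => <-.
    rewrite -!(big_mkord xpredT (fun i => (m i)^-1)).
    rewrite [leRHS](big_cat_nat (n := L))//=; last by lia.
    by rewrite lerDl; apply: sumr_ge0 => i _; rewrite invr_ge0 ltW.
  lra.
move=> n t e e0.
have [N hN] : exists N, C * 2 ^+ n * M n / e <= 2 ^+ N.
  exists (Num.truncn (C * 2 ^+ n * M n / e)).+1.
  have := @ltn_expl 2 (Num.truncn (C * 2 ^+ n * M n / e)).+1 isT.
  rewrite -(ltr_nat R) natrX => h.
  exact: (le_trans (ltW (truncnS_gt _)) (ltW h)).
apply: Dle (allbeta N t n).
rewrite (_ : _ * M n = C * 2 ^+ n * M n / 2 ^+ N); last by rewrite mulrA mulrAC.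
by rewrite ler_pdivrMr ?exprn_gt0// [leRHS]mulrC -ler_pdivrMr.
Qed.

(** A dyadic argument: G_(2n) is at most G_n / 4 plus a term of [a], and since G decreases, its sum
    S is at most G_1 plus twice the sum over even indices. Hence S <= G_1 + S/2 + 2B. *)
Lemma carleman_inequality (R : realType) (a G : nat -> R) (B : R) :
  (forall i, 0 < a i) -> {homo a : i j / (i <= j)%N >-> j <= i} ->
  (forall n, 0 <= G n) ->
  (forall n, (0 < n)%N -> G n ^+ n = \prod_(i < n) a i) ->
  (forall L, \sum_(i < L) a i <= B) ->
  forall L, \sum_(n < L) G n.+1 <= 2 * G 1 + 4 * B.
Proof.
move=> a0 ani G0 GX aB L.
have aG n : a n.+1 <= G n.+1.
  rewrite -(@ler_pXn2r _ n.+1) ?nnegrE ?(ltW (a0 _))// GX//.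
  have <- : \prod_(i < n.+1) a n.+1 = a n.+1 ^+ n.+1 by rewrite prodr_const card_ord.
  apply: ler_prod => i _; rewrite ltW//=; apply: ani; have := ltn_ord i; lia.
have Gni n : G n.+2 <= G n.+1.
  rewrite -(@ler_pXn2r _ n.+2) ?nnegrE// GX// big_ord_recr/= -GX// [leRHS]exprSr.
  by rewrite ler_wpM2l ?exprn_ge0.
(* The last n+1 of the 2(n+1) factors are at most [a n], so G_(2(n+1)) is at most the square root of
   xy with x = [G n.+1] and y = [a n]; this root is at most x/4 + y. *)
have G2 n : G (2 * n.+1)%N <= G n.+1 / 4 + a n.
  have x0 := G0 n.+1; have y0 := a0 n.
  rewrite -(@ler_pXn2r _ (2 * n.+1)%N) ?nnegrE//; last by rewrite ltW// ltr_wpDl ?divr_ge0.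
  rewrite GX// exprM.
  rewrite -(big_mkord xpredT a) (big_cat_nat (n := n.+1))//=; last by lia.
  rewrite big_mkord -GX//.
  apply: (@le_trans _ _ (G n.+1 ^+ n.+1 * a n ^+ n.+1)).
    rewrite ler_wpM2l ?exprn_ge0//.
    rewrite big_nat.
    apply: (@le_trans _ _ (\prod_(n.+1 <= i < 2 * n.+1) a n)).
      rewrite [leRHS]big_nat; apply: ler_prod => i /andP[ni _].
      by rewrite ltW//= ani//; lia.
    by rewrite prodr_const_nat (_ : (2 * n.+1 - n.+1 = n.+1)%N)//; lia.
  rewrite -exprMn lerXn2r ?nnegrE ?sqr_ge0 ?mulr_ge0 ?(ltW y0)//.
  set x := G n.+1 in x0 *; set y := a n in y0 *.
  rewrite -subr_ge0 (_ : _ - _ = (x / 4 - y) ^+ 2); first exact: sqr_ge0.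
  by rewrite !expr2; field.
have S2 N : \sum_(n < (2 * N).+1) G n.+1 <= G 1 + 2 * \sum_(n < N) G (2 * n.+1)%N.
  elim: N => [|N IH]; first by rewrite muln0 big_ord_recr !big_ord0/=; lra.
  rewrite (_ : (2 * N.+1).+1 = (2 * N).+3)%N; last by lia.
  rewrite big_ord_recr big_ord_recr [X in 2 * X]big_ord_recr/=.
  have := Gni (2 * N).+1; rewrite (_ : (2 * N).+2 = (2 * N.+1)%N); last by lia.
  lra.
have SL : \sum_(n < L) G n.+1 <= \sum_(n < (2 * L).+1) G n.+1.
  rewrite -!(big_mkord xpredT (fun n => G n.+1)) [leRHS](big_cat_nat (n := L))//=; last by lia.
  by rewrite lerDl sumr_ge0.
have SG : \sum_(n < L) G (2 * n.+1)%N <= (\sum_(n < L) G n.+1) / 4 + B.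
  apply: (@le_trans _ _ (\sum_(n < L) (G n.+1 / 4 + a n))).
    by apply: ler_sum => n _; exact: G2.
  by rewrite big_split/= -mulr_suml lerD2l aB.
have := S2 L; lra.
Qed.

Lemma powR_root (R : realType) (x : R) (n : nat) :
  (0 < n)%N -> 0 <= x -> (x `^ n%:R^-1) ^+ n = x.
Proof.
move=> n0 x0; rewrite -powR_mulrn ?powR_ge0// -powRrM mulVf ?powRr1//.
by rewrite pnatr_eq0 -lt0n.
Qed.

(** Here [s n] stands for the moment of order 2n, whence the exponent 1/(2n) and the squares of [m].
    The condition for all l is log-convexity written linearly in s, so it passes to u = s + 1. The
    shift keeps the ratios of u defined when moments vanish; [m] consists of the square roots of
    these ratios, which increase. *)
Lemma carleman_majorant (R : realType) (s : nat -> R) :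
  (forall n, 0 <= s n) ->
  (forall n l, 0 < l -> 2 * s n.+1 <= l * s n + l^-1 * s n.+2) ->
  (\sum_(1 <= n <oo) ((s n `^ (2 * n)%:R^-1)%:E)^-1 = +oo)%E ->
  exists m C, [/\ forall i, 0 < m i :> R, {homo m : i j / (i <= j)%N >-> i <= j},
    forall A, exists L, A <= \sum_(i < L) (m i)^-1, 0 <= C :> R &
    forall n, s n <= C * \prod_(i < n) m i ^+ 2].
Proof.
move=> s0 slc sdiv.
pose u n := s n + 1.
have u1 n : 1 <= u n by rewrite lerDr.
have u0 n : 0 < u n by rewrite (lt_le_trans _ (u1 n)).
pose r i := u i.+1 / u i.
have r0 i : 0 < r i by rewrite divr_gt0.
have rS i : r i <= r i.+1.
  have : 2 * u i.+1 <= r i * u i + (r i)^-1 * u i.+2.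
    have := slc i (r i) (r0 i).
    have : 2 <= r i + (r i)^-1.
      rewrite -subr_ge0 (_ : _ - 2 = (r i - 1) ^+ 2 / r i); first by rewrite divr_ge0 ?sqr_ge0// ltW.
      by field; rewrite gt_eqF.
    by rewrite /u; lra.
  rewrite /r (_ : u i.+1 / u i * u i = u i.+1); last by rewrite divfK// gt_eqF.
  rewrite invf_div [u i / _ * _]mulrC mulrA -lerBlDl (_ : 2 * _ - _ = u i.+1); last by lra.
  by rewrite ler_pdivlMr// [u i.+1 / u i <= _]ler_pdivrMr// mulrAC ler_pdivlMr.
pose m i := Num.sqrt (r i).
have m0 i : 0 < m i by rewrite sqrtr_gt0.
have mnd : {homo m : i j / (i <= j)%N >-> i <= j}.
  by apply: homo_leq => [//|y x z|i]; [exact: le_trans|rewrite /= /m ler_sqrt ?rS// ltW].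
have m2 i : m i ^+ 2 = r i by rewrite sqr_sqrtr// ltW.
have pm n : \prod_(i < n) m i ^+ 2 = u n / u 0%N.
  elim: n => [|n IH]; first by rewrite big_ord0 divff// gt_eqF.
  rewrite big_ord_recr/= IH m2 /r mulrC mulrA divfK// gt_eqF//.
exists m, (u 0%N); split => //; last 2 first.
- exact: ltW.
- by move=> n; rewrite pm mulrC divfK ?gt_eqF// /u lerDl.
(* If the sums of the 1/m_i were bounded, Carleman's inequality would bound those of G_n = (u_0 /
   u_n)^(1/(2n)), and then those of s_n^(-1/(2n)). *)
apply: contrapT => /existsNP[A /forallNP nex].
have hA L : \sum_(i < L) (m i)^-1 <= A by rewrite ltW// ltNge; exact/negP/nex.
have a0 i : 0 < (m i)^-1 by rewrite invr_gt0.
have ani : {homo (fun i => (m i)^-1) : i j / (i <= j)%N >-> j <= i}.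
  by move=> i j ij; rewrite lef_pV2 ?posrE// mnd.
pose G n := (\prod_(i < n) (m i)^-1) `^ n%:R^-1.
have G0 n : 0 < G n by rewrite powR_gt0// prodr_gt0.
have GX n : (0 < n)%N -> G n ^+ n = \prod_(i < n) (m i)^-1.
  by move=> n0; rewrite powR_root// prodr_ge0// => i _; exact: ltW.
have hG L := carleman_inequality a0 ani (fun n => ltW (G0 n)) GX hA L.
set B := 2 * G 1%N + 4 * A in hG.
pose w n := u n `^ (2 * n)%:R^-1.
have w0 n : 0 < w n by rewrite powR_gt0.
have wX n : w n.+1 ^+ (2 * n.+1) = u n.+1 by rewrite powR_root// ltW.
have wG n : (w n.+1)^-1 <= G n.+1.
  rewrite -(@ler_pXn2r _ (2 * n.+1)%N) ?nnegrE ?invr_ge0 ?(ltW (w0 _)) ?(ltW (G0 _))//.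
  rewrite exprVn wX mulnC exprM GX// -prodrXl.
  under eq_bigr do rewrite exprVn.
  by rewrite prodfV pm invf_div ler_peMl// invr_ge0 ltW.
(* Once G_n < 1/4, u_n^(1/(2n)) exceeds 4, and s_n = u_n - 1 is at least u_n / 4^n: undoing the
   shift costs a factor 2 in the roots. *)
have [n0 hn0] : exists n0, forall n, (n0 <= n)%N -> G n.+1 < 4^-1.
  have : (fun n => G n.+1) @ \oo --> (0 : R).
    apply: (@cvg_series_cvg_0 _ R^o); apply: nondecreasing_is_cvgn.
      apply/nondecreasing_seqP => n; rewrite /series/= big_nat_recr//=.
      by rewrite lerDl ltW.
    by exists B => _ [L _ <-]; rewrite /series/= big_mkord.
  move=> /cvgr_lt /(_ (4^-1)); rewrite invr_gt0 ltr0n => /(_ isT) [n0 _ h].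
  by exists n0 => n /h.
pose x n := s n `^ (2 * n)%:R^-1.
have x0 n : 0 <= x n by exact: powR_ge0.
have xX n : x n.+1 ^+ (2 * n.+1) = s n.+1 by rewrite powR_root.
have wx n : (n0 <= n)%N -> w n.+1 / 2 <= x n.+1.
  move=> /hn0 Gn.
  have w4 : 4 < w n.+1.
    have := le_lt_trans (wG n) Gn.
    by rewrite ltf_pV2// ?posrE.
  have u4 : 4 <= 4 ^+ n.+1 :> R by rewrite ler_eXnr// ler1n.
  have uu : 4 ^+ n.+1 <= u n.+1.
    rewrite -wX exprM lerXn2r ?nnegrE ?sqr_ge0// expr2.
    by apply: (le_trans (ltW w4)); rewrite ler_peMr ?(ltW (w0 _))//; lra.
  rewrite -(@ler_pXn2r _ (2 * n.+1)%N) ?nnegrE ?divr_ge0 ?(ltW (w0 _))// xX.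
  rewrite exprMn wX exprVn exprM (_ : 2 ^+ 2 = 4 :> R); last by rewrite expr2; lra.
  apply: (@le_trans _ _ (u n.+1 / 4)).
    by rewrite ler_wpM2l ?(ltW (u0 _))// lef_pV2 ?posrE ?exprn_gt0.
  by move: uu u4; rewrite /u; lra.
(* A vanishing s_n would contribute +oo to the series. By log-convexity with l large, all later
   terms would vanish too, against the lower bound [wx]. *)
have s_gt0 n : 0 < s n.+1.
  rewrite lt_neqAle s0 andbT eq_sym; apply/eqP => sn.
  have sz j : s (n.+1 + j)%N = 0.
    elim: j => [|j IH]; first by rewrite addn0.
    rewrite addnS; apply/eqP; rewrite eq_le s0 andbT; apply/ler_addgt0Pl => e e0.
    have := slc (n.+1 + j)%N ((s (n.+1 + j).+2 + 1) / e).
    have t0 : 0 < s (n.+1 + j).+2 + 1 by rewrite ltr_wpDl.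
    rewrite divr_gt0// IH mulr0 add0r invf_div => /(_ isT).
    have : e / (s (n.+1 + j).+2 + 1) * s (n.+1 + j).+2 <= e.
      by rewrite mulrAC ler_pdivrMr// ler_wpM2l ?(ltW e0)// lerDl.
    have := s0 (n.+1 + j).+1; lra.
  have := wx (n + n0)%N (leq_addl _ _); rewrite /x -addSn sz powR0.
    by have := w0 (n.+1 + n0)%N; lra.
  by rewrite invr_eq0 pnatr_eq0.
have x_gt0 n : 0 < x n.+1 by rewrite powR_gt0.
(* The 2 serves the indices from n0 on; the sum absorbs the finitely many earlier ones. *)
pose K := 2 + \sum_(j < n0) (x j.+1)^-1 / G j.+1.
have K2 : 2 <= K.
  by rewrite lerDl sumr_ge0// => j _; rewrite divr_ge0 ?invr_ge0// ltW.
have xK n : (x n.+1)^-1 <= K * G n.+1.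
  have [nn0|nn0] := leqP n0 n.
    apply: (@le_trans _ _ (2 * G n.+1)); last by rewrite ler_wpM2r ?(ltW (G0 _)).
    apply: (@le_trans _ _ (2 * (w n.+1)^-1)); last by rewrite ler_wpM2l.
    have h : 2 * (w n.+1)^-1 = (w n.+1 / 2)^-1 by rewrite invf_div.
    by rewrite h lef_pV2 ?posrE ?divr_gt0// wx.
  rewrite -ler_pdivrMr// /K (bigD1 (Ordinal nn0))//= addrCA lerDl.
  by rewrite addr_ge0// sumr_ge0// => j _; rewrite divr_ge0 ?invr_ge0// ltW.
suff : (\sum_(1 <= n <oo) ((s n `^ (2 * n)%:R^-1)%:E)^-1 <= (K * B)%:E)%E.
  by rewrite sdiv leye_eq.
apply: lime_le.
  apply: is_cvg_nneseries => n _ _; rewrite inver; case: ifP => // _.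
  by rewrite lee_fin invr_ge0 powR_ge0.
apply: nearW => -[|L]; first by rewrite big_geq// lee_fin mulr_ge0// ?(le_trans _ (hG 0%N)) ?big_ord0//; lra.
rewrite big_add1/= big_mkord.
apply: (@le_trans _ _ (\sum_(i < L) (K * G i.+1)%:E)%E).
  apply: lee_sum => i _; rewrite inver gt_eqF ?x_gt0// lee_fin; exact: xK.
by rewrite sumEFin lee_fin -mulr_sumr ler_wpM2l//; lra.
Qed.

(** Each of the k factors of a block is at most the first entry of the next block; this is why the
    samples start at k and not at 0. *)
Lemma prod_subsample_le (R : realType) (m : nat -> R) (k n : nat) :
  (forall i, 0 < m i) -> {homo m : i j / (i <= j)%N >-> i <= j} ->
  \prod_(i < k * n) m i <= (\prod_(i < n) m (k * i.+1)%N) ^+ k.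
Proof.
move=> m0 mnd; elim: n => [|n IH]; first by rewrite muln0 !big_ord0 expr1n.
rewrite big_ord_recr/= exprMn -(big_mkord xpredT m).
rewrite (big_cat_nat (n := (k * n)%N))//=; last by rewrite leq_mul2l leqnSn orbT.
rewrite big_mkord ler_pM//.
- by rewrite prodr_ge0// => i _; exact: ltW.
- by rewrite prodr_ge0// => i _; exact: ltW.
apply: (@le_trans _ _ (\prod_(k * n <= i < k * n.+1) m (k * n.+1)%N)).
  rewrite big_nat [leRHS]big_nat; apply: ler_prod => i /andP[_ ni].
  by rewrite ltW//= mnd// ltnW.
by rewrite prodr_const_nat -mulnBr subSnn muln1.
Qed.

(** The terms 1/m_i decrease, so a block of k of them is at most k times its first one. The initial
    block has no sample and is carried along as a constant. *)
Lemma sum_subsample_diverges (R : realType) (m : nat -> R) (k : nat) :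
  (0 < k)%N -> (forall i, 0 < m i) -> {homo m : i j / (i <= j)%N >-> i <= j} ->
  (forall A, exists L, A <= \sum_(i < L) (m i)^-1) ->
  forall A, exists L, A <= \sum_(i < L) (m (k * i.+1)%N)^-1.
Proof.
move=> k0 m0 mnd mdiv A.
have H L : \sum_(j < k * L.+1) (m j)^-1 <=
    \sum_(j < k) (m j)^-1 + k%:R * \sum_(i < L) (m (k * i.+1)%N)^-1.
  elim: L => [|L IH]; first by rewrite muln1 big_ord0 mulr0 addr0.
  rewrite -(big_mkord xpredT (fun j => (m j)^-1)).
  rewrite (big_cat_nat (n := (k * L.+1)%N))//=; last by rewrite leq_mul2l leqnSn orbT.
  rewrite big_mkord big_ord_recr/= mulrDr addrA lerD//.
  apply: (@le_trans _ _ (\sum_(k * L.+1 <= i < k * L.+2) (m (k * L.+1)%N)^-1)).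
    rewrite big_nat [leRHS]big_nat; apply: ler_sum => i /andP[ni _].
    by rewrite lef_pV2 ?posrE// mnd.
  by rewrite big_const_nat iter_addr_0 -mulnBr subSnn muln1 mulr_natl.
have [L hL] := mdiv (k%:R * A + \sum_(j < k) (m j)^-1).
exists L; have kR : 0 < k%:R :> R by rewrite ltr0n.
rewrite -(ler_pM2l kR).
suff : \sum_(i < L) (m i)^-1 <= \sum_(j < k * L.+1) (m j)^-1.
  by have := H L; move: hL; lra.
rewrite -!(big_mkord xpredT (fun j => (m j)^-1)) [leRHS](big_cat_nat (n := L))//=.
  by rewrite lerDl sumr_ge0// => i _; rewrite invr_ge0 ltW.
by rewrite mulnS (leq_trans _ (leq_addl _ _))// leq_pmull.
Qed.

(** * Taylor's formula for cosine and sine *)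

(** The mean value theorem gives no factor 1/(K+1), so the Taylor bounds derived from it carry no
    factorials; [bang] takes them in this form. *)
Lemma mvt_power_bound (R : realType) (f f' : R -> R) (K : nat) :
  (forall x : R, is_derive x (1 : R) f (f' x)) -> f 0 = 0 ->
  (forall x, `|f' x| <= `|x| ^+ K) -> forall u, `|f u| <= `|u| ^+ K.+1.
Proof.
move=> df f0 bf u.
have cf x : {for x, continuous f}.
  by apply: differentiable_continuous; apply/derivable1_diffP; have := df x; case.
have key a b : a < b -> exists2 c, a <= c <= b & f b - f a = f' c * (b - a).
  move=> ab; have [] := @MVT _ f f' _ _ ab (fun x _ => df x).
    by apply: continuous_subspaceT.
  by move=> c /[!in_itv]/= /andP[ac cb] E; exists c => //; rewrite !ltW.
have [u0|u0|->] := ltgtP u 0.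
- have [c /andP[uc c0]] := key _ _ u0.
  rewrite f0 !sub0r mulrN => /oppr_inj ->; rewrite normrM exprSr ler_wpM2r//.
  by apply: (le_trans (bf c)); rewrite lerXn2r ?nnegrE// !ler0_norm ?lerN2// ltW.
- have [c /andP[c0 cu]] := key _ _ u0.
  rewrite f0 !subr0 => ->; rewrite normrM exprSr ler_wpM2r//.
  by apply: (le_trans (bf c)); rewrite lerXn2r ?nnegrE// !ger0_norm// ltW.
- by rewrite f0 normr0 exprn_ge0.
Qed.

Lemma is_derive_taylor_sum (R : realType) (c : nat -> R) (K : nat) (x : R) :
  is_derive x (1 : R) (fun u => \sum_(k < K.+1) c k * u ^+ k / k`!%:R)
    (\sum_(k < K) c k.+1 * x ^+ k / k`!%:R).
Proof.
elim: K => [|K IH].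
  rewrite big_ord0.
  under eq_fun do rewrite big_ord_recr big_ord0/= add0r expr0 mulr1.
  exact: is_derive_cst.
rewrite big_ord_recr/=; under eq_fun do rewrite big_ord_recr/=.
apply: is_deriveD.
have -> : (fun u => c K.+1 * u ^+ K.+1 / K.+1`!%:R) =
    (c K.+1 / K.+1`!%:R) \*: (id ^+ K.+1 : R -> R).
  by apply/funext => u; rewrite fctE/= mulrAC.
apply: is_derive_eq; rewrite /= /GRing.scale/= mulr1 factS natrM invfM.
rewrite -!mulrA; congr (_ * _).
by rewrite mulrCA mulKf ?pnatr_eq0// mulrC.
Qed.

(* The coefficients satisfy [c k = 'Re ('i ^+ k)] and [s k = 'Im ('i ^+ k)]. *)
Lemma cos_sin_taylor (R : realType) (c s : nat -> R) :
  c 0 = 1 -> s 0 = 0 -> (forall k, c k.+1 = - s k) -> (forall k, s k.+1 = c k) ->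
  forall K u, `|cos u - \sum_(k < K) c k * u ^+ k / k`!%:R| <= `|u| ^+ K /\
              `|sin u - \sum_(k < K) s k * u ^+ k / k`!%:R| <= `|u| ^+ K.
Proof.
move=> c0 s0 cS sS.
have S0 (a : nat -> R) K : \sum_(k < K.+1) a k * 0 ^+ k / k`!%:R = a 0%N.
  rewrite big_ord_recl/= expr0 mulr1 fact0 divr1 big1 ?addr0// => i _.
  by rewrite exprS mul0r mulr0 mul0r.
elim=> [|K IH] u.
  by rewrite !big_ord0 !subr0 expr0 cos_max sin_max.
split.
- apply: (@mvt_power_bound _ (fun u => cos u - \sum_(k < K.+1) c k * u ^+ k / k`!%:R)
    (fun u => - (sin u - \sum_(k < K) s k * u ^+ k / k`!%:R)) K).
  + move=> x; rewrite opprB addrC.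
    rewrite (_ : \sum_(k < K) s k * x ^+ k / k`!%:R = - \sum_(k < K) c k.+1 * x ^+ k / k`!%:R).
      by apply: is_deriveB; exact: is_derive_taylor_sum.
    by rewrite -sumrN; apply: eq_bigr => k _; rewrite cS !mulNr opprK.
  + by rewrite S0 cos0 c0 subrr.
  + by move=> x; rewrite normrN; exact: (IH x).2.
- apply: (@mvt_power_bound _ (fun u => sin u - \sum_(k < K.+1) s k * u ^+ k / k`!%:R)
    (fun u => cos u - \sum_(k < K) c k * u ^+ k / k`!%:R) K).
  + move=> x.
    under [X in _ - X]eq_bigr do rewrite -sS.
    by apply: is_deriveB; exact: is_derive_taylor_sum.
  + by rewrite S0 sin0 s0 subrr.
  + by move=> x; exact: (IH x).1.
Qed.

(** * Complex-valued functions and their L_p norms *)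

Local Notation normc := Normc.normc.

Section ComplexMeasurable.
Context {R : realType} {d : measure_display} {T : measurableType d}.
Implicit Types (f g : T -> R[i]) (a : R[i]).

Lemma normc_ge0 (z : R[i]) : 0 <= normc z.
Proof. by case: z => x y; exact: sqrtr_ge0. Qed.

Lemma normc_real (x : R) : normc (real_complex _ x) = `|x|.
Proof. by rewrite /= expr0n/= addr0 sqrtr_sqr. Qed.

Lemma normcX (z : R[i]) n : normc (z ^+ n) = normc z ^+ n.
Proof. by elim: n => [|n IH]; rewrite ?expr0 ?Normc.normc1// !exprS Normc.normcM IH. Qed.

Lemma normc_le_ReIm (z : R[i]) : normc z <= `|complex.Re z| + `|complex.Im z|.
Proof.
case: z => x y /=; rewrite -(@ler_pXn2r _ 2) ?nnegrE ?sqrtr_ge0 ?addr_ge0//.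
rewrite sqr_sqrtr ?addr_ge0 ?sqr_ge0// sqrrD !real_normK ?num_real//.
by rewrite -addrA lerD2l lerDr mulrn_wge0 ?mulr_ge0.
Qed.

Lemma Re_le_normc (z : R[i]) : `|complex.Re z| <= normc z.
Proof. by case: z => x y /=; rewrite -sqrtr_sqr ler_wsqrtr// lerDl sqr_ge0. Qed.

Lemma Im_le_normc (z : R[i]) : `|complex.Im z| <= normc z.
Proof. by case: z => x y /=; rewrite -sqrtr_sqr ler_wsqrtr// lerDr sqr_ge0. Qed.

Lemma complexReM (z w : R[i]) : complex.Re (z * w) =
  complex.Re z * complex.Re w - complex.Im z * complex.Im w.
Proof. by case: z; case: w. Qed.

Lemma complexImM (z w : R[i]) : complex.Im (z * w) =
  complex.Re z * complex.Im w + complex.Im z * complex.Re w.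
Proof. by case: z; case: w. Qed.

Lemma cmeasurable_cst a : cmeasurable (fun _ : T => a).
Proof. by split; exact: measurable_cst. Qed.

Lemma cmeasurable_real (f : T -> R) :
  measurable_fun setT f -> cmeasurable (fun x => real_complex _ (f x)).
Proof. by move=> mf; split => //=; exact: measurable_cst. Qed.

Lemma cmeasurableD f g : cmeasurable f -> cmeasurable g ->
  cmeasurable (fun x => f x + g x).
Proof.
move=> [mf1 mf2] [mg1 mg2]; split.
  by under eq_fun do rewrite raddfD; exact: measurable_funD.
by under eq_fun do rewrite raddfD; exact: measurable_funD.
Qed.

Lemma cmeasurableM f g : cmeasurable f -> cmeasurable g ->
  cmeasurable (fun x => f x * g x).
Proof.
move=> [mf1 mf2] [mg1 mg2]; split.
  by under eq_fun do rewrite complexReM; apply: measurable_funB; exact: measurable_funM.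
by under eq_fun do rewrite complexImM; apply: measurable_funD; exact: measurable_funM.
Qed.

Lemma cmeasurableZ a f : cmeasurable f -> cmeasurable (fun x => a * f x).
Proof. by move=> mf; apply: cmeasurableM => //; exact: cmeasurable_cst. Qed.

Lemma cmeasurableB f g : cmeasurable f -> cmeasurable g ->
  cmeasurable (fun x => f x - g x).
Proof.
move=> mf mg; under eq_fun do rewrite -mulN1r.
by apply: cmeasurableD => //; exact: cmeasurableZ.
Qed.

Lemma cmeasurable_sum n (F : 'I_n -> T -> R[i]) : (forall i, cmeasurable (F i)) ->
  cmeasurable (fun x => \sum_(i < n) F i x).
Proof.
elim: n F => [|n IH] F mF.
  by under eq_fun do rewrite big_ord0; exact: cmeasurable_cst.
by under eq_fun do rewrite big_ord_recr; apply: cmeasurableD => //; exact: IH.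
Qed.

Lemma measurable_normc f : cmeasurable f -> measurable_fun setT (fun x => normc (f x)).
Proof.
move=> [m1 m2].
rewrite (_ : (fun _ => _) = Num.sqrt \o (fun x => complex.Re (f x) ^+ 2 + complex.Im (f x) ^+ 2)).
  apply: measurableT_comp; first by apply: continuous_measurable_fun; exact: sqrt_continuous.
  by apply: measurable_funD; exact: measurable_funX.
by apply/funext => x /=; case: (f x).
Qed.

End ComplexMeasurable.

Section cLnorm.
Context {R : realType} {d : measure_display} {T : measurableType d}.
Variable mu : {measure set T -> \bar R}.
Implicit Types (f g : T -> R[i]) (a : R[i]) (p : R).
Local Open Scope ereal_scope.

Lemma cLnormE p f : cLnorm mu p f =
  (\int[mu]_x ((normc (f x) `^ p)%R)%:E) `^ p^-1.
Proof.
rewrite /cLnorm unlock; congr (_ `^ _); apply: eq_integral => x _.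
by rewrite gee0_abs ?lee_fin ?normc_ge0// poweR_EFin.
Qed.

Lemma cLnorm_ge0 p f : 0 <= cLnorm mu p f.
Proof. exact: Lnorm_ge0. Qed.

Lemma measurable_normc_powR p f : cmeasurable f ->
  measurable_fun setT (fun x => ((normc (f x) `^ p)%R)%:E).
Proof.
move=> mf; apply/measurable_EFinP.
by apply: (@measurableT_comp _ _ _ _ _ _ (@powR R ^~ p)) => //; exact: measurable_normc.
Qed.

Lemma le_cLnorm p f g : (0 < p)%R -> cmeasurable f -> cmeasurable g ->
  (forall x, normc (f x) <= normc (g x))%R -> cLnorm mu p f <= cLnorm mu p g.
Proof.
move=> p0 mf mg fg; rewrite !cLnormE; apply: gt0_ler_poweR.
- by rewrite invr_ge0 ltW.
- by rewrite in_itv/= leey integral_ge0// => x _; rewrite lee_fin powR_ge0.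
- by rewrite in_itv/= leey integral_ge0// => x _; rewrite lee_fin powR_ge0.
apply: ge0_le_integral => //.
- by move=> x _; rewrite lee_fin powR_ge0.
- exact: measurable_normc_powR.
- exact: measurable_normc_powR.
- by move=> x _; rewrite lee_fin ge0_ler_powR ?nnegrE ?normc_ge0// ltW.
Qed.

Lemma cLnormD p f g : (1 <= p)%R -> cmeasurable f -> cmeasurable g ->
  cLnorm mu p (fun x => f x + g x)%R <= cLnorm mu p f + cLnorm mu p g.
Proof.
move=> p1 mf mg; have mnf := measurable_normc mf; have mng := measurable_normc mg.
apply: (@le_trans _ _ (cLnorm mu p (fun x => real_complex _ (normc (f x) + normc (g x))%R))).
  apply: le_cLnorm; first by rewrite (lt_le_trans _ p1).
  - exact: cmeasurableD.
  - by apply: cmeasurable_real; exact: measurable_funD.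
  - by move=> x; rewrite normc_real ger0_norm ?addr_ge0 ?normc_ge0// le_normcD.
have := minkowski_EFin mu mnf mng p1; rewrite /cLnorm => /(le_trans _); apply.
rewrite le_eqVlt; apply/orP; left; apply/eqP; apply: eq_Lnorm => x.
by rewrite normc_real ger0_norm ?addr_ge0 ?normc_ge0.
Qed.

Lemma cLnormZ p a f : (0 < p)%R -> cmeasurable f ->
  cLnorm mu p (fun x => a * f x)%R = (normc a)%:E * cLnorm mu p f.
Proof.
move=> p0 mf; rewrite !cLnormE.
under eq_integral do rewrite Normc.normcM powRM ?normc_ge0// EFinM.
rewrite ge0_integralZl//; first last.
- by rewrite lee_fin powR_ge0.
- by move=> x _; rewrite lee_fin powR_ge0.
- exact: measurable_normc_powR.
rewrite poweRM ?lee_fin ?powR_ge0//; last first.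
  by rewrite integral_ge0// => x _; rewrite lee_fin powR_ge0.
by rewrite poweR_EFin -powRrM divff ?gt_eqF// powRr1 ?normc_ge0.
Qed.

(** Hoelder's inequality for |f|^p and |g|^p. The case r = s = 2 separates y^j from f; the case g =
    1 compares L_p with L_q. *)
Lemma cLnorm_hoelder p r s f g : (0 < p)%R -> (0 < r)%R -> (0 < s)%R ->
  (r^-1 + s^-1 = 1)%R -> cmeasurable f -> cmeasurable g ->
  cLnorm mu p (fun x => f x * g x)%R <= cLnorm mu (p * r) f * cLnorm mu (p * s) g.
Proof.
move=> p0 r0 s0 rs mf mg.
have mp (h : T -> R[i]) : cmeasurable h -> measurable_fun setT (fun x => normc (h x) `^ p)%R.
  by move=> mh; apply/measurable_EFinP; exact: (measurable_normc_powR p mh).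
have /= := hoelder mu (mp _ mf) (mp _ mg) r0 s0 rs.
rewrite Lnorm1 unlock !cLnormE.
under eq_integral do rewrite /= ger0_norm ?mulr_ge0 ?powR_ge0// -powRM ?normc_ge0// -Normc.normcM.
under [X in _ <= X `^ _ * _]eq_integral do rewrite /= ger0_norm ?powR_ge0// -powRrM.
under [X in _ <= _ * X `^ _]eq_integral do rewrite /= ger0_norm ?powR_ge0// -powRrM.
move=> h.
rewrite !invfM ![(p^-1 * _)%R]mulrC !poweRrM -poweRM ?poweR_ge0//.
apply: gt0_ler_poweR => //.
- by rewrite invr_ge0 ltW.
- by rewrite in_itv/= leey integral_ge0// => x _; rewrite lee_fin powR_ge0.
- by rewrite in_itv/= leey mule_ge0 ?poweR_ge0.
Qed.

Lemma cLnorm_cst p a : (0 < p)%R ->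
  cLnorm mu p (fun=> a) = (normc a)%:E * mu setT `^ p^-1.
Proof.
move=> p0; rewrite cLnormE integral_cst// poweRM ?lee_fin ?powR_ge0//.
by rewrite poweR_EFin -powRrM divff ?gt_eqF// powRr1 ?normc_ge0.
Qed.

Lemma cLnorm_comparison p q : (0 < p)%R -> (p < q)%R -> mu setT < +oo ->
  exists2 C : R, (0 < C)%R &
    forall f, cmeasurable f -> cLnorm mu p f <= C%:E * cLnorm mu q f.
Proof.
move=> p0 pq fin.
have q0 : (0 < q)%R by exact: lt_trans pq.
pose r := (q / p)%R; pose s := (q / (q - p))%R.
have qp0 : (0 < q - p)%R by rewrite subr_gt0.
have fmu : mu setT `^ (p * s)^-1 \is a fin_num.
  by rewrite fin_num_poweR// ge0_fin_numE.
(* The added 1 keeps the constant positive for the zero measure, so that one can divide by it. *)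
exists (fine (mu setT `^ (p * s)^-1) + 1)%R.
  by rewrite ltr_wpDl// fine_ge0// poweR_ge0.
move=> f mf.
have r0 : (0 < r)%R by rewrite divr_gt0.
have s0 : (0 < s)%R by rewrite divr_gt0.
have rs : (r^-1 + s^-1 = 1)%R by rewrite /r /s !invf_div -mulrDl addrC subrK divff// gt_eqF.
have := cLnorm_hoelder p0 r0 s0 rs mf (cmeasurable_cst 1%R).
rewrite {1}/r [(p * (q / p))%R]mulrC divfK ?gt_eqF// cLnorm_cst ?(mulr_gt0 p0 s0)//.
rewrite Normc.normc1 mul1e.
under [X in cLnorm mu p X]eq_fun do rewrite mulr1.
move=> h; apply: (le_trans h).
by rewrite muleC -{1}(fineK fmu) lee_wpmul2r ?cLnorm_ge0// lee_fin lerDl.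
Qed.

Lemma cLnorm_lty p f : (0 < p)%R -> cLnorm mu p f < +oo <->
  \int[mu]_x ((normc (f x) `^ p)%R)%:E < +oo.
Proof.
move=> p0; rewrite cLnormE; split => [|h]; last exact: poweR_lty.
by apply: lty_poweRy; rewrite invr_neq0// gt_eqF.
Qed.

Lemma cLnorm_dominated p (h : nat -> T -> R[i]) (G : T -> R[i]) : (0 < p)%R ->
  (forall n, cmeasurable (h n)) -> cmeasurable G -> cLnorm mu p G < +oo ->
  (forall n x, normc (h n x) <= normc (G x))%R ->
  (forall x, normc (h n x) @[n --> \oo] --> (0%R : R)) ->
  forall e : R, (0 < e)%R -> exists n, cLnorm mu p (h n) < e%:E.
Proof.
move=> p0 mh mG /(cLnorm_lty _ p0) iG hG h0 e e0.
have [] := @dominated_convergence _ _ _ mu setT measurableT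
  (fun n x => ((normc (h n x) `^ p)%R)%:E) (cst 0)
  (fun x => ((normc (G x) `^ p)%R)%:E).
- by move=> n; exact: measurable_normc_powR.
- exact: measurable_cst.
- apply: aeW => x _; apply: cvg_EFin; first by near=> n.
  apply/cvgr0Pnorm_lt => eps eps0.
  have := h0 x => /cvgr_lt /(_ (eps `^ p^-1)%R); rewrite powR_gt0// => /(_ isT).
  apply: filterS => n hn /=; rewrite ger0_norm ?powR_ge0//.
  rewrite -[ltRHS](@powRr1 _ eps) ?ltW// -(@mulVf _ p) ?gt_eqF// powRrM.
  by rewrite gt0_ltr_powR// nnegrE ?normc_ge0 ?powR_ge0.
- apply/integrableP; split; first exact: measurable_normc_powR.
  by under eq_integral do rewrite gee0_abs ?lee_fin ?powR_ge0//.
- apply: aeW => x n _; rewrite gee0_abs ?lee_fin ?powR_ge0//.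
  by rewrite ge0_ler_powR ?nnegrE ?normc_ge0// ltW.
move=> _ _; rewrite integral0 => /fine_cvgP[[N1 _ fin]] /cvgr_lt /(_ (e `^ p)%R).
rewrite powR_gt0// => /(_ isT) [N2 _ hN].
pose n := maxn N1 N2; exists n.
have := hN n (leq_maxr _ _); have /= := fin n (leq_maxl _ _).
rewrite cLnormE => fn hn.
rewrite -[e](@powRr1 _ e) ?ltW// -(@mulfV _ p) ?gt_eqF// powRrM -poweR_EFin -(fineK fn).
rewrite !poweR_EFin lte_fin gt0_ltr_powR// ?invr_gt0// nnegrE ?powR_ge0//.
by rewrite fine_ge0// integral_ge0// => x _; rewrite lee_fin powR_ge0.
Unshelve. all: by end_near. Qed.

End cLnorm.

(** * Distance to a subspace of L_p *)

(** The L_p distance from f to V is at most c; for c = 0, f is in the closure of V. Only upper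
    bounds on distances enter the argument, so the infimum itself is never formed. *)
Definition Lp_near {R : realType} {d} {T : measurableType d} (mu : {measure set T -> \bar R})
    (p : R) (V : set (T -> R[i])) (c : R) (f : T -> R[i]) : Prop :=
  forall e : R, 0 < e ->
    exists2 g, V g & (cLnorm mu p (fun x => f x - g x)%R < (c + e)%:E)%E.

Record measurable_subspace {R : realType} {d} {T : measurableType d}
    (V : set (T -> R[i])) : Prop := MeasurableSubspace {
  subspace0 : V (fun=> 0);
  subspaceD : forall f g, V f -> V g -> V (fun x => f x + g x);
  subspaceZ : forall a f, V f -> V (fun x => a * f x);
  subspace_measurable : forall f, V f -> cmeasurable f }.

Section LpNear.
Context {R : realType} {d : measure_display} {T : measurableType d}.
Variables (mu : {measure set T -> \bar R}) (p : R) (V : set (T -> R[i])).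
Hypotheses (p1 : 1 <= p) (hV : measurable_subspace V).
Implicit Types (f g : T -> R[i]) (a : R[i]) (c : R).

Let p0 : 0 < p. Proof. exact: lt_le_trans p1. Qed.

Lemma Lp_near_ge0 c f : Lp_near mu p V c f -> 0 <= c.
Proof.
move=> h; apply/ler_addgt0Pr => e e0; have [g _ /(le_lt_trans (cLnorm_ge0 _ _ _))] := h e e0.
by rewrite lte_fin => /ltW.
Qed.

Lemma Lp_near_le c c' f : c <= c' -> Lp_near mu p V c f -> Lp_near mu p V c' f.
Proof.
move=> cc h e e0; have [g Vg hg] := h e e0; exists g => //.
by apply: (lt_le_trans hg); rewrite lee_fin lerD2r.
Qed.

Lemma Lp_near_norm c f : (cLnorm mu p f <= c%:E)%E -> Lp_near mu p V c f.
Proof.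
move=> h e e0; exists (fun=> 0); first exact: subspace0.
under eq_fun do rewrite subr0.
by rewrite (le_lt_trans h)// lte_fin ltrDl.
Qed.

Lemma Lp_near_subspace f : V f -> Lp_near mu p V 0 f.
Proof.
move=> Vf e e0; exists f => //; under eq_fun do rewrite subrr.
by rewrite cLnorm_cst// Normc.normc0 mul0e add0r lte_fin.
Qed.

Lemma Lp_nearD c c' f g : cmeasurable f -> cmeasurable g ->
  Lp_near mu p V c f -> Lp_near mu p V c' g ->
  Lp_near mu p V (c + c') (fun x => f x + g x).
Proof.
move=> mf mg hf hg e e0.
have e2 : 0 < e / 2 by rewrite divr_gt0.
have [f' Vf hf'] := hf _ e2; have [g' Vg hg'] := hg _ e2.
exists (fun x => f' x + g' x); first exact: subspaceD.
have -> : (fun x => f x + g x - (f' x + g' x)) = (fun x => (f x - f' x) + (g x - g' x)).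
  by apply/funext => x; rewrite opprD addrACA.
have mf' := subspace_measurable hV Vf; have mg' := subspace_measurable hV Vg.
apply: (le_lt_trans (cLnormD mu p1 (cmeasurableB mf mf') (cmeasurableB mg mg'))).
have -> : c + c' + e = (c + e / 2) + (c' + e / 2) by lra.
by rewrite EFinD lteD.
Qed.

Lemma Lp_nearZ a c f : cmeasurable f -> Lp_near mu p V c f ->
  Lp_near mu p V (normc a * c) (fun x => a * f x).
Proof.
move=> mf hf e e0; have c0 := Lp_near_ge0 hf.
have a1 : 0 < normc a + 1 by rewrite ltr_wpDl// normc_ge0.
have [g Vg hg] := hf (e / (normc a + 1)) (divr_gt0 e0 a1).
exists (fun x => a * g x); first exact: subspaceZ.
under eq_fun do rewrite -mulrBr.
rewrite cLnormZ//; last exact: (cmeasurableB mf (subspace_measurable hV Vg)).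
have [->|an0] := eqVneq (normc a) 0.
  by rewrite mul0e mul0r add0r lte_fin.
apply: (@lt_le_trans _ _ ((normc a)%:E * (c + e / (normc a + 1))%:E)%E).
  by rewrite lte_pmul2l// lte_fin lt_neqAle eq_sym an0 normc_ge0.
rewrite -EFinM lee_fin mulrDr lerD2l mulrCA ger_pMr// ler_pdivrMr// mul1r.
by rewrite lerDl.
Qed.

Lemma Lp_near_sum n (F : 'I_n -> T -> R[i]) (c : 'I_n -> R) :
  (forall i, cmeasurable (F i)) -> (forall i, Lp_near mu p V (c i) (F i)) ->
  Lp_near mu p V (\sum_(i < n) c i) (fun x => \sum_(i < n) F i x).
Proof.
elim: n F c => [|n IH] F c mF hF.
  rewrite big_ord0; under [X in Lp_near _ _ _ _ X]eq_fun do rewrite big_ord0.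
  by apply: Lp_near_subspace; exact: (subspace0 hV).
rewrite big_ord_recr/=; under [X in Lp_near _ _ _ _ X]eq_fun do rewrite big_ord_recr/=.
apply: Lp_nearD => //; first exact: cmeasurable_sum.
exact: IH.
Qed.

Lemma Lp_near_approx c f : cmeasurable f ->
  (forall e : R, 0 < e -> exists h, [/\ cmeasurable h, Lp_near mu p V c h &
    (cLnorm mu p (fun x => f x - h x)%R < e%:E)%E]) -> Lp_near mu p V c f.
Proof.
move=> mf hf e e0; have e2 : 0 < e / 2 by rewrite divr_gt0.
have [h [mh hh fh]] := hf _ e2; have [g Vg hg] := hh _ e2.
exists g => //; have mg := subspace_measurable hV Vg.
have -> : (fun x => f x - g x) = (fun x => (f x - h x) + (h x - g x)).
  by apply/funext => x; rewrite addrA subrK.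
apply: (le_lt_trans (cLnormD mu p1 (cmeasurableB mf mh) (cmeasurableB mh mg))).
have -> : c + e = e / 2 + (c + e / 2) by lra.
by rewrite EFinD lteD.
Qed.

End LpNear.

Lemma Lp_near_trans {R : realType} {d} {T : measurableType d}
    (mu : {measure set T -> \bar R}) (p : R) (V W : set (T -> R[i])) f :
  1 <= p -> measurable_subspace V -> measurable_subspace W -> cmeasurable f ->
  (forall g, W g -> Lp_near mu p V 0 g) -> Lp_near mu p W 0 f -> Lp_near mu p V 0 f.
Proof.
move=> p1 hV hW mf WV hf; apply: Lp_near_approx => // e e0.
have [g Wg hg] := hf e e0; exists g; rewrite add0r in hg; split => //.
  exact: (subspace_measurable hW Wg).
exact: WV.
Qed.

Lemma Lp_near_comparison {R : realType} {d} {T : measurableType d}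
    (mu : {measure set T -> \bar R}) (p q : R) (V : set (T -> R[i])) f :
  0 < p -> p < q -> (mu setT < +oo)%E -> measurable_subspace V -> cmeasurable f ->
  Lp_near mu q V 0 f -> Lp_near mu p V 0 f.
Proof.
move=> p0 pq fin hV mf hf e e0.
have [C C0 hC] := cLnorm_comparison p0 pq fin.
have [g Vg] := hf (e / C) (divr_gt0 e0 C0); rewrite !add0r => hg; exists g => //.
have mg := subspace_measurable hV Vg.
apply: (le_lt_trans (hC _ (cmeasurableB mf mg))).
have -> : e%:E = (C%:E * (e / C)%:E)%E by rewrite -EFinM mulrC divfK// gt_eqF.
by rewrite lte_pmul2l.
Qed.

(** * Functions of polynomial growth on R^n *)

Section Borel.
Context {R : realType} {n : nat}.
Local Notation T := (borelRn R n).

Lemma measurable_coord (j : 'I_n) :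
  measurable_fun setT (fun x : T => (x : 'rV[R]_n) ord0 j).
Proof.
apply: (measurability _ (RGenOpens.measurableE R)) => // _ [A [a [b ->]] <-].
rewrite setTI; apply: sub_sigma_algebra.
have /continuousP := @coord_continuous R 1 n ord0 j; exact.
Qed.

Lemma measurable_inner (v : 'rV[R]_n) : measurable_fun setT (fun x : T => inner v x).
Proof.
rewrite /inner; apply: measurable_sum => j.
by apply: measurable_funM => //; exact: measurable_coord.
Qed.

Lemma enorm_ge0 (x : 'rV[R]_n) : 0 <= enorm x.
Proof. exact: sqrtr_ge0. Qed.

Lemma measurable_enorm : measurable_fun setT (fun x : T => enorm x).
Proof.
rewrite (_ : (fun _ => _) = Num.sqrt \o (fun x : T => inner (x : 'rV[R]_n) x))//.
apply: measurableT_comp.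
  by apply: continuous_measurable_fun; exact: sqrt_continuous.
rewrite /inner; apply: measurable_sum => j.
by apply: measurable_funM; exact: measurable_coord.
Qed.

Lemma coord_le_enorm (x : 'rV[R]_n) j : `|x ord0 j| <= enorm x.
Proof.
rewrite -sqrtr_sqr ler_wsqrtr// /inner (bigD1 j)//= -expr2 lerDl.
by apply: sumr_ge0 => i _; rewrite -expr2 sqr_ge0.
Qed.

Lemma inner_le_enorm (v x : 'rV[R]_n) : `|inner v x| <= (\sum_j `|v ord0 j|) * enorm x.
Proof.
rewrite (le_trans (ler_norm_sum _ _ _))// mulr_suml ler_sum// => j _.
by rewrite normrM ler_wpM2l// coord_le_enorm.
Qed.

Lemma innerDl (u v x : 'rV[R]_n) : inner (u + v) x = inner u x + inner v x.
Proof. by rewrite /inner -big_split; apply: eq_bigr => j _; rewrite mxE mulrDl. Qed.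

Lemma innerZl a (v x : 'rV[R]_n) : inner (a *: v) x = a * inner v x.
Proof. by rewrite /inner mulr_sumr; apply: eq_bigr => j _; rewrite mxE mulrA. Qed.

Lemma innerN (v x : 'rV[R]_n) : inner (- v) x = - inner v x.
Proof. by rewrite -scaleN1r innerZl mulN1r. Qed.

(** An algebra that contains the polynomials and the exponentials and lies in every L_p(mu) with mu
    in [Mstar]; all integrability below is reduced to it. *)
Definition tempered (f : T -> R[i]) : Prop :=
  cmeasurable f /\
  exists2 C : R, 0 <= C & exists k, forall x, normc (f x) <= C * (1 + enorm x) ^+ k.

Lemma tempered_cst a : tempered (fun=> a).
Proof.
split; first exact: cmeasurable_cst.
by exists (normc a); [exact: normc_ge0|exists 0%N => x; rewrite expr0 mulr1].
Qed.

Lemma temperedM f g : tempered f -> tempered g -> tempered (fun x => f x * g x).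
Proof.
move=> [mf [C C0 [k hf]]] [mg [D D0 [l hg]]]; split; first exact: cmeasurableM.
exists (C * D); first exact: mulr_ge0.
exists (k + l)%N => x; rewrite Normc.normcM exprD mulrACA.
by rewrite ler_pM ?normc_ge0.
Qed.

Lemma temperedD f g : tempered f -> tempered g -> tempered (fun x => f x + g x).
Proof.
move=> [mf [C C0 [k hf]]] [mg [D D0 [l hg]]]; split; first exact: cmeasurableD.
exists (C + D); first exact: addr_ge0.
exists (k + l)%N => x; rewrite (le_trans (le_normcD _ _))// mulrDl.
have e1 : 1 <= 1 + enorm x by rewrite lerDl enorm_ge0.
apply: lerD.
  by apply: (le_trans (hf x)); rewrite ler_wpM2l// ler_weXn2l// leq_addr.
by apply: (le_trans (hg x)); rewrite ler_wpM2l// ler_weXn2l// leq_addl.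
Qed.

Lemma temperedX f k : tempered f -> tempered (fun x => f x ^+ k).
Proof.
move=> hf; elim: k => [|k IH]; first exact: tempered_cst.
by under eq_fun do rewrite exprS; exact: temperedM.
Qed.

Lemma tempered_coord j : tempered (fun x => real_complex _ ((x : 'rV[R]_n) ord0 j)).
Proof.
split; first by apply: cmeasurable_real; exact: measurable_coord.
exists 1 => //; exists 1%N => x; rewrite normc_real mul1r expr1.
by rewrite (le_trans (coord_le_enorm _ _))// lerDr.
Qed.

Lemma tempered_inner v : tempered (fun x => real_complex _ (inner v x)).
Proof.
split; first by apply: cmeasurable_real; exact: measurable_inner.
exists (\sum_j `|v ord0 j|); first by rewrite sumr_ge0.
exists 1%N => x; rewrite normc_real expr1 (le_trans (inner_le_enorm _ _))//.
by rewrite ler_wpM2l ?sumr_ge0// lerDr.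
Qed.

Lemma tempered_bounded f : cmeasurable f -> (forall x, normc (f x) <= 1) -> tempered f.
Proof.
by move=> mf hf; split => //; exists 1 => //; exists 0%N => x; rewrite expr0 mulr1.
Qed.

Variable mu : {measure set T -> \bar R}.
Hypothesis hmu : Mstar mu.

Lemma Mstar_finite : (mu setT < +oo)%E.
Proof.
(* The moment of order 0 is the total mass, as the power with exponent 0 is 1 also at the origin. *)
have := hmu (lexx 0); under eq_integral do rewrite powRr0.
by rewrite integral_cst// mul1e.
Qed.

Lemma tempered_Lp f p : 0 < p -> tempered f -> (cLnorm mu p f < +oo)%E.
Proof.
move=> p0 [mf [C C0 [k hf]]].
have me : measurable_fun setT (fun x : T => (1 + enorm x) ^+ k).
  by apply: measurable_funX; apply: measurable_funD => //; exact: measurable_enorm.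
apply: (@le_lt_trans _ _ (cLnorm mu p (fun x : T => (real_complex _ C) * real_complex _ ((1 + enorm x) ^+ k)))).
  apply: le_cLnorm => //.
    exact: (cmeasurableZ _ (cmeasurable_real me)).
  move=> x; rewrite Normc.normcM !normc_real !ger0_norm ?exprn_ge0 ?addr_ge0 ?enorm_ge0//.
rewrite (cLnormZ mu _ p0 (cmeasurable_real me)).
suff : (cLnorm mu p (fun x : T => real_complex _ ((1 + enorm x) ^+ k)) < +oo)%E.
  move=> h; apply: lte_mul_pinfty => //; first by rewrite lee_fin normc_ge0.
apply/cLnorm_lty => //.
pose q := k%:R * p; have q0 : 0 <= q by rewrite mulr_ge0// ltW.
(* (1 + r)^q is at most 2^q if r <= 1, and at most (2r)^q otherwise. *)
apply: (@le_lt_trans _ _ (\int[mu]_x ((2 `^ q)%:E + (2 `^ q)%:E * (enorm x `^ q)%:E))%E).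
  have mq : measurable_fun setT (fun x : T => (enorm x `^ q)%:E).
    apply/measurable_EFinP; apply: (@measurableT_comp _ _ _ _ _ _ (@powR R ^~ q)) => //.
    exact: measurable_enorm.
  apply: ge0_le_integral => //.
  - by move=> x _; rewrite lee_fin powR_ge0.
  - exact: (measurable_normc_powR p (cmeasurable_real me)).
  - apply: emeasurable_funD => //; apply: emeasurable_funM => //.
  move=> x _; have e0 := enorm_ge0 x.
  rewrite -EFinM -EFinD lee_fin normc_real ger0_norm ?exprn_ge0 ?addr_ge0//.
  rewrite -powR_mulrn ?addr_ge0// -powRrM -/q.
  have [x1|x1] := leP (enorm x) 1.
    apply: (@le_trans _ _ (2 `^ q)); last by rewrite lerDl mulr_ge0 ?powR_ge0.
    by rewrite ge0_ler_powR ?nnegrE ?addr_ge0//; lra.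
  apply: (@le_trans _ _ ((2 * enorm x) `^ q)).
    by rewrite ge0_ler_powR ?nnegrE ?addr_ge0 ?mulr_ge0//; lra.
  by rewrite powRM// lerDr powR_ge0.
rewrite ge0_integralD//; first last.
- apply: emeasurable_funM => //; apply/measurable_EFinP.
  apply: (@measurableT_comp _ _ _ _ _ _ (@powR R ^~ q)) => //; exact: measurable_enorm.
- by move=> x _; rewrite -EFinM lee_fin mulr_ge0 ?powR_ge0.
apply: lte_add_pinfty.
  rewrite integral_cst// lte_mul_pinfty// ?lee_fin ?powR_ge0//; exact: Mstar_finite.
have mq : measurable_fun setT (fun x : T => (enorm x `^ q)%:E).
  apply/measurable_EFinP; apply: (@measurableT_comp _ _ _ _ _ _ (@powR R ^~ q)) => //.
  exact: measurable_enorm.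
rewrite (_ : \int[mu]_x _ = (2 `^ q)%:E * \int[mu]_x (enorm x `^ q)%:E)%E.
  by apply: lte_mul_pinfty => //; exact: hmu.
by apply: ge0_integralZl => // x _; rewrite lee_fin powR_ge0.
Qed.

End Borel.

(** * Polynomials and exponentials on R^n *)

Lemma cexp_i {R : realType} (r : R) :
  cexp (('i%C : R[i]) * real_complex _ r) = Complex (cos r) (sin r).
Proof.
rewrite /cexp complexReM complexImM /= !mul0r !mul1r subr0 add0r expR0.
by apply/eqP; rewrite eq_complex /= !mul1r !mul0r subr0 addr0 !eqxx.
Qed.

Lemma normc_cexp_i {R : realType} (r : R) : normc (cexp (('i%C : R[i]) * real_complex _ r)) = 1.
Proof. by rewrite cexp_i /= cos2Dsin2 sqrtr1. Qed.

Lemma cexp_iD {R : realType} (r s : R) :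
  cexp (('i%C : R[i]) * real_complex _ (r + s)) =
  cexp ('i%C * real_complex _ r) * cexp ('i%C * real_complex _ s).
Proof.
rewrite !cexp_i cosD sinD; apply/eqP; rewrite eq_complex /= eqxx/=.
by rewrite [X in _ == X]addrC.
Qed.

Lemma normc_i {R : realType} : normc ('i%C : R[i]) = 1.
Proof. by rewrite /= expr0n/= add0r expr1n sqrtr1. Qed.

Lemma cexp_taylor {R : realType} (K : nat) (u : R) :
  normc (cexp (('i%C : R[i]) * real_complex _ u) -
    \sum_(k < K) 'i%C ^+ k * real_complex _ (u ^+ k / k`!%:R)) <= 2 * `|u| ^+ K.
Proof.
pose c k := complex.Re ('i%C ^+ k : R[i]); pose s k := complex.Im ('i%C ^+ k : R[i]).
have [] := @cos_sin_taylor R c s _ _ _ _ K u.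
- by rewrite /c expr0.
- by rewrite /s expr0.
- by move=> k; rewrite /c exprS complexReM/= mul0r mul1r sub0r.
- by move=> k; rewrite /s exprS complexImM/= mul0r mul1r add0r.
move=> h1 h2; rewrite (le_trans (normc_le_ReIm _))// mulr_natl mulr2n lerD//.
  rewrite cexp_i raddfB raddf_sum/=.
  by under eq_bigr do rewrite complexReM/= mulr0 subr0 mulrA.
rewrite cexp_i raddfB raddf_sum/=.
by under eq_bigr do rewrite complexImM/= mulr0 add0r mulrA.
Qed.

Section Polynomials.
Context {R : realType} {n : nat}.
Local Notation T := (borelRn R n).
Local Notation coord j := (fun x : T => real_complex R ((x : 'rV[R]_n) ord0 j)).

Lemma poly_funD (P Q : mpoly.mpoly n R[i]) : @poly_fun R n (P + Q) = (fun x => poly_fun P x + poly_fun Q x).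
Proof. by apply/funext => x; rewrite /poly_fun mpoly.mevalD. Qed.

Lemma poly_funM (P Q : mpoly.mpoly n R[i]) : @poly_fun R n (P * Q) = (fun x => poly_fun P x * poly_fun Q x).
Proof. by apply/funext => x; rewrite /poly_fun mpoly.mevalM. Qed.

Lemma poly_funC a : @poly_fun R n (mpoly.mpolyC n a) = (fun=> a).
Proof. by apply/funext => x; rewrite /poly_fun mpoly.mevalC. Qed.

(** Monomials are built one coordinate factor at a time, because each such factor will cost one
    differentiation in the frequency. *)
Lemma poly_fun_ind (Q : set (T -> R[i])) : Q (fun=> 1) ->
  (forall f g, Q f -> Q g -> Q (fun x => f x + g x)) ->
  (forall a f, Q f -> Q (fun x => a * f x)) ->
  (forall j f, Q f -> Q (fun x => coord j x * f x)) ->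
  forall P, Q (poly_fun P).
Proof.
move=> Q1 QD QZ QX P.
have -> : poly_fun P = (fun x => \sum_(m <- mpoly.msupp P)
    mpoly.mcoeff m P * \prod_(i < n) (coord i x) ^+ (m i)).
  by apply/funext => x; rewrite /poly_fun mpoly.mevalE.
elim: (mpoly.msupp P) => [|m s IH].
  have := QZ 0 _ Q1; congr Q; apply/funext => x; by rewrite big_nil mul0r.
have -> : (fun x => \sum_(m0 <- m :: s) mpoly.mcoeff m0 P * \prod_(i < n) (coord i x) ^+ (m0 i)) =
  (fun x => mpoly.mcoeff m P * \prod_(i < n) (coord i x) ^+ (m i) +
     \sum_(m0 <- s) mpoly.mcoeff m0 P * \prod_(i < n) (coord i x) ^+ (m0 i)).
  by apply/funext => x; rewrite big_cons.
apply: QD => //; apply: QZ.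
elim: (index_enum _) => [|j r IHr].
  by have := Q1; congr Q; apply/funext => x; rewrite big_nil.
have -> : (fun x => \prod_(i <- j :: r) (coord i x) ^+ (m i)) =
    (fun x => (coord j x) ^+ (m j) * \prod_(i <- r) (coord i x) ^+ (m i)).
  by apply/funext => x; rewrite big_cons.
elim: (m j) => [|k IHk].
  by have := IHr; congr Q; apply/funext => x; rewrite expr0 mul1r.
have -> : (fun x => coord j x ^+ k.+1 * \prod_(i <- r) (coord i x) ^+ (m i)) =
  (fun x => coord j x * (coord j x ^+ k * \prod_(i <- r) (coord i x) ^+ (m i))).
  by apply/funext => x; rewrite exprS mulrA.
exact: QX.
Qed.

Lemma tempered_poly_fun P : tempered (@poly_fun R n P).
Proof.
apply: poly_fun_ind.
- exact: tempered_cst.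
- exact: temperedD.
- by move=> a f hf; apply: temperedM => //; exact: tempered_cst.
- by move=> j f hf; apply: temperedM => //; exact: tempered_coord.
Qed.

Lemma poly_subspace : measurable_subspace (range (@poly_fun R n)).
Proof.
split.
- by exists (mpoly.mpolyC n 0) => //; rewrite poly_funC.
- by move=> _ _ [P _ <-] [Q _ <-]; exists (P + Q) => //; rewrite poly_funD.
- by move=> a _ [P _ <-]; exists (mpoly.mpolyC n a * P) => //; rewrite poly_funM poly_funC.
- by move=> _ [P _ <-]; have [] := tempered_poly_fun P.
Qed.

Lemma poly_inner_pow v k : exists P, @poly_fun R n P = (fun x => real_complex _ (inner v x) ^+ k).
Proof.
exists ((\sum_j mpoly.mpolyC n (real_complex _ (v ord0 j)) * mpoly.mpolyX _ (mpoly.mnm1 j)) ^+ k).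
apply/funext => x; rewrite /poly_fun rmorphXn/= rmorph_sum/= /inner; congr (_ ^+ _).
rewrite rmorph_sum/=; apply: eq_bigr => j _.
by rewrite mpoly.mevalM mpoly.mevalC mpoly.mevalXU rmorphM.
Qed.

End Polynomials.

Section Exponentials.
Context {R : realType} {n : nat}.
Local Notation T := (borelRn R n).

Lemma normc_expi (l : 'rV[R]_n) x : normc (expi l x) = 1.
Proof. exact: normc_cexp_i. Qed.

Lemma normc_expiM (l : 'rV[R]_n) x z : normc (expi l x * z) = normc z.
Proof. by rewrite Normc.normcM normc_expi mul1r. Qed.

Lemma expiD (l m : 'rV[R]_n) x : expi (l + m) x = expi l x * expi m x.
Proof. by rewrite /expi innerDl cexp_iD. Qed.

Lemma expi0 x : expi (0 : 'rV[R]_n) x = 1.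
Proof.
rewrite /expi (_ : inner 0 x = 0); last first.
  by rewrite /inner big1// => j _; rewrite mxE mul0r.
by rewrite cexp_i cos0 sin0.
Qed.

Lemma tempered_expi (l : 'rV[R]_n) : tempered (expi l).
Proof.
apply: tempered_bounded; last by move=> x; rewrite normc_expi.
rewrite /expi; under eq_fun do rewrite cexp_i.
split => /=.
  apply: (@measurableT_comp _ _ _ _ _ _ (@cos R)); last exact: measurable_inner.
  by apply: continuous_measurable_fun; exact: continuous_cos.
apply: (@measurableT_comp _ _ _ _ _ _ (@sin R)); last exact: measurable_inner.
by apply: continuous_measurable_fun; exact: continuous_sin.
Qed.

End Exponentials.

(** * Propagation along one direction *)

Section QuasiAnalytic.
Context {R : realType} {n : nat}.
Local Notation T := (borelRn R n).
Variable mu : {measure set T -> \bar R}.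
Hypothesis hmu : Mstar mu.

Lemma tempered_integrable (h : T -> R) : tempered (fun x => real_complex _ (h x)) ->
  mu.-integrable setT (EFin \o h).
Proof.
move=> hh; apply/integrableP; split.
  by apply/measurable_EFinP; have [[]] := hh.
have /cLnorm_lty := tempered_Lp hmu ltr01 hh.
rewrite ltr01 => /(_ isT); under eq_integral do rewrite powRr1 ?normc_ge0// normc_real.
by [].
Qed.

Lemma tempered_inner_pow v k : tempered (fun x : T => real_complex R (inner v x ^+ k)).
Proof.
by under eq_fun do rewrite rmorphXn; apply: temperedX; exact: tempered_inner.
Qed.

Lemma integral_moment v k :
  (\int[mu]_x (inner v x ^+ k)%:E)%E = (moment mu v k)%:E.
Proof.
rewrite /moment /Rintegral fineK//; apply: integrable_fin_num => //.
exact: (tempered_integrable (tempered_inner_pow v k)).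
Qed.

Lemma moment_even_ge0 v k : 0 <= moment mu v (2 * k)%N.
Proof.
rewrite -lee_fin -integral_moment integral_ge0// => x _.
by rewrite lee_fin exprM exprn_ge0// sqr_ge0.
Qed.

(** Integrate (l y^k - y^(k+2))^2 / l >= 0 with y = (v, x). *)
Lemma moment_log_convex v k l : 0 < l ->
  2 * moment mu v (2 * k.+1)%N <=
  l * moment mu v (2 * k)%N + l^-1 * moment mu v (2 * k.+2)%N.
Proof.
move=> l0; have im j := tempered_integrable (tempered_inner_pow v j).
have iZ a j : mu.-integrable setT (EFin \o (fun x : T => a * inner v x ^+ j)).
  by have := integrableZl measurableT a (im j).
have Z a j : a * moment mu v j = \int[mu]_x (a * inner v x ^+ j).
  by rewrite /moment RintegralZl//; exact: im.
rewrite !Z -RintegralD//.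
apply: le_Rintegral => //.
  by have := integrableD measurableT (iZ l (2 * k)%N) (iZ l^-1 (2 * k.+2)%N).
move=> x _; set y := inner v x.
rewrite -subr_ge0 (_ : _ - _ = (l * y ^+ k - y ^+ k.+2) ^+ 2 / l).
  by rewrite divr_ge0 ?sqr_ge0// ltW.
by rewrite !mulnS mul2n -addnn !exprD !exprS; field; rewrite gt_eqF.
Qed.

End QuasiAnalytic.

(** The form of Carleman's condition used from here on. Adding a measure with the same moments only
    doubles C, with the same [m], so the property passes to mu + nu directly. *)
Definition moment_majorant {R : realType} {n : nat}
    (mu : {measure set (borelRn R n) -> \bar R}) (v : 'rV[R]_n) : Prop :=
  exists (m : nat -> R) (C : R), [/\ forall i, 0 < m i, {homo m : i j / (i <= j)%N >-> i <= j},
    forall A, exists L, A <= \sum_(i < L) (m i)^-1, 0 <= C &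
    forall k, (\int[mu]_x (inner v x ^+ (2 * k))%:E <= (C * \prod_(i < k) m i ^+ 2)%:E)%E].

Lemma carleman_moment_majorant {R : realType} {n : nat}
    (mu : {measure set (borelRn R n) -> \bar R}) (v : 'rV[R]_n) :
  Mstar mu -> carleman (moment mu v) -> moment_majorant mu v.
Proof.
move=> hmu hc.
have [m [C [m0 mnd mdiv C0 hm]]] := @carleman_majorant R (fun k => moment mu v (2 * k)%N)
  (moment_even_ge0 hmu v) (fun k l => @moment_log_convex _ _ _ hmu v k l) hc.
by exists m, C; split => // k; rewrite integral_moment// lee_fin.
Qed.

(** The 2k-th power of the L_{2k} norm of y^j is the moment of order 2kj, bounded by C times the
    product of the m_i^2 over i < kj. Blocks of k indices turn this product into a 2k-th power. *)
Lemma moment_majorant_cLnorm {R : realType} {n : nat}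
    (mu : {measure set (borelRn R n) -> \bar R}) (v : 'rV[R]_n) (k : nat) : (0 < k)%N ->
  moment_majorant mu v ->
  exists (m : nat -> R) (C : R), [/\ forall i, 0 < m i, {homo m : i j / (i <= j)%N >-> i <= j},
    forall A, exists L, A <= \sum_(i < L) (m i)^-1, 0 <= C &
    forall j, (cLnorm mu (k%:R * 2) (fun x => real_complex _ (inner v x) ^+ j)%R <=
      (C * \prod_(i < j) m i)%:E)%E].
Proof.
move=> k0 [m [C [m0 mnd mdiv C0 hm]]].
pose q : R := k%:R * 2.
have q0 : 0 < q by rewrite mulr_gt0// ltr0n.
exists (fun i => m (k * i.+1)%N), (C `^ q^-1); split.
- by [].
- by move=> i j ij; apply: mnd; rewrite leq_mul2l ltnS ij orbT.
- exact: sum_subsample_diverges.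
- exact: powR_ge0.
move=> j; rewrite cLnormE.
have E x : normc (real_complex _ (inner v x) ^+ j) `^ q = inner v x ^+ (2 * (k * j)).
  rewrite normcX normc_real -[`|_| ^+ j]powR_mulrn// -powRrM /q -(natrM _ k 2) -natrM powR_mulrn//.
  rewrite (_ : (j * (k * 2) = 2 * (k * j))%N); last by lia.
  by rewrite !exprM real_normK ?num_real.
under eq_integral do rewrite -/q E.
set P := \prod_(i < j) m (k * i.+1)%N.
have P0 : 0 <= P by apply: prodr_ge0 => i _; exact: ltW.
apply: (@le_trans _ _ ((C * P ^+ (k * 2))%:E `^ q^-1)%E).
  apply: gt0_ler_poweR.
  - by rewrite invr_ge0 ltW.
  - rewrite in_itv/= leey andbT integral_ge0// => x _.
    by rewrite lee_fin exprM exprn_ge0// sqr_ge0.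
  - by rewrite in_itv/= leey andbT lee_fin mulr_ge0// exprn_ge0.
  apply: (le_trans (hm _)); rewrite lee_fin ler_wpM2l// exprM prodrXl.
  by rewrite lerXn2r ?nnegrE ?prod_subsample_le// ?exprn_ge0// prodr_ge0// => i _; exact: ltW.
rewrite poweR_EFin lee_fin powRM ?exprn_ge0// ler_wpM2l ?powR_ge0//.
by rewrite -powR_mulrn// -powRrM natrM -/q divff ?gt_eqF// powRr1.
Qed.

Section Step.
Context {R : realType} {n : nat}.
Local Notation T := (borelRn R n).
Variables (mu : {measure set T -> \bar R}) (k : nat) (V : set (T -> R[i])).
Hypotheses (hmu : Mstar mu) (k0 : (0 < k)%N) (hV : measurable_subspace V).

(** [bang] is applied to the distances of the F_j(s) to V. The hypothesis on all y^j f says that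
    they vanish at s = 0; the a priori bound is Hoelder's, with f in L_{2k} because it has
    polynomial growth. *)
Lemma quasianalytic_transport v (f : T -> R[i]) (t : R) : moment_majorant mu v ->
  tempered f ->
  (forall j, Lp_near mu k%:R V 0 (fun x => real_complex _ (inner v x) ^+ j * f x)) ->
  Lp_near mu k%:R V 0 (fun x => expi (t *: v) x * f x).
Proof.
move=> mm hf h0.
have k1 : 1 <= k%:R :> R by rewrite ler1n.
have kp : 0 < k%:R :> R by rewrite ltr0n.
have k2 : 0 < k%:R * 2 :> R by rewrite mulr_gt0.
have [m [C [m0 mnd mdiv C0 hm]]] := moment_majorant_cLnorm k0 mm.
pose y (x : T) : R[i] := real_complex _ (inner v x).
pose F j s (x : T) := y x ^+ j * (expi (s *: v) x * f x).
have ty j : tempered (fun x => y x ^+ j) by apply: temperedX; exact: tempered_inner.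
have mF j s : cmeasurable (F j s).
  by have [] := temperedM (ty j) (temperedM (tempered_expi (s *: v)) hf).
have mYf j : cmeasurable (fun x => y x ^+ j * f x) by have [] := temperedM (ty j) hf.
set B := cLnorm mu (k%:R * 2) f.
have Bf : B \is a fin_num by rewrite ge0_fin_numE ?cLnorm_ge0// tempered_Lp.
have B0 : 0 <= fine B by rewrite fine_ge0// cLnorm_ge0.
have hY j : (cLnorm mu k%:R (fun x => y x ^+ j * f x)%R <=
    (C * fine B * \prod_(i < j) m i)%:E)%E.
  have h2 : (2^-1 + 2^-1 = 1 :> R) by lra.
  have [my _] := ty j; have [mf _] := hf.
  apply: (le_trans (cLnorm_hoelder mu kp (ltr0Sn R 1) (ltr0Sn R 1) h2 my mf)).
  rewrite -/B -(fineK Bf) (_ : C * _ * _ = C * \prod_(i < j) m i * fine B); last by ring.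
  rewrite [X in (_ <= X)%E]EFinM; apply: lee_wpmul2r; first by rewrite lee_fin.
  exact: hm.
have expiZ s x : expi (s *: v) x = cexp ('i%C * real_complex _ (s * inner v x)).
  by rewrite /expi innerZl.
(* The factor 2 in the constant is that of [cexp_taylor], where the real and imaginary remainders
   are added. *)
have main : forall j s e, 0 < e -> Lp_near mu k%:R V e (F j s).
  apply: (@bang R m (2 * (C * fine B)) (fun j s c => Lp_near mu k%:R V c (F j s))) => //.
  - by rewrite !mulr_ge0.
  - by move=> *; apply: Lp_near_le; eassumption.
  - move=> j s; apply: Lp_near_norm => //.
    apply: (@le_trans _ _ (cLnorm mu k%:R (fun x => y x ^+ j * f x))).
      apply: le_cLnorm => // x.
      by rewrite /F Normc.normcM normc_expiM -Normc.normcM.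
    apply: (le_trans (hY j)); rewrite lee_fin ler_wpM2r//.
      by rewrite prodr_ge0// => i _; exact: ltW.
    by rewrite ler_peMl ?mulr_ge0// ler1n.
  - move=> j; have := h0 j; congr Lp_near; apply/funext => x.
    by rewrite /F scale0r expi0 mul1r.
  move=> j s h K c hc.
  (* Each differentiation in s multiplies F_j by iy, that is, by i and a shift of j. The moduli of
     these coefficients are then bounded by |h|^i. *)
  pose a i : R[i] := 'i%C ^+ i * real_complex _ (h ^+ i / i`!%:R).
  pose Rem (x : T) := F j (s + h) x - \sum_(i < K) a i * F (j + i)%N s x.
  have mS : cmeasurable (fun x => \sum_(i < K) a i * F (j + i)%N s x).
    by apply: cmeasurable_sum => i; exact: cmeasurableZ.
  have mR : cmeasurable Rem by exact: cmeasurableB.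
  have -> : F j (s + h) = (fun x => \sum_(i < K) a i * F (j + i)%N s x + Rem x).
    by apply/funext => x; rewrite /Rem subrKC.
  apply: Lp_nearD => //.
    apply: (@Lp_near_le _ _ _ _ _ _ (\sum_(i < K) normc (a i) * c i)).
      apply: ler_sum => i _; rewrite ler_wpM2r ?(Lp_near_ge0 (hc i (ltn_ord i)))//.
      rewrite Normc.normcM normcX normc_i expr1n mul1r normc_real normrM normrX.
      rewrite [`|_^-1|]ger0_norm ?invr_ge0// ler_piMr ?exprn_ge0// invf_le1 ?ltr0n ?fact_gt0//.
      by rewrite ler1n fact_gt0.
    apply: Lp_near_sum => // i; first exact: cmeasurableZ.
    by apply: Lp_nearZ => //; exact: hc.
  apply: Lp_near_norm => //.
  pose b : R[i] := real_complex _ (2 * `|h| ^+ K).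
  have b0 : normc b = 2 * `|h| ^+ K.
    by rewrite normc_real ger0_norm// mulr_ge0// exprn_ge0.
  (* Pointwise, the remainder is F_j(s) times the Taylor remainder of e^(ihy), which is at most 2
     |h|^K |y|^K. *)
  apply: (@le_trans _ _ (cLnorm mu k%:R (fun x => b * (y x ^+ (j + K) * f x)))).
    apply: le_cLnorm => //; first exact: cmeasurableZ.
    move=> x.
    have -> : Rem x = (cexp ('i%C * real_complex _ (h * inner v x)) -
       \sum_(i < K) 'i%C ^+ i * real_complex _ ((h * inner v x) ^+ i / i`!%:R)) *
       (y x ^+ j * (expi (s *: v) x * f x)).
      rewrite /Rem mulrBl mulr_suml; congr (_ - _).
        by rewrite /F scalerDl expiD [expi (h *: v) x]expiZ; ring.
      apply: eq_bigr => i _.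
      have -> : real_complex _ ((h * inner v x) ^+ i / i`!%:R) =
          real_complex _ (h ^+ i / i`!%:R) * y x ^+ i.
        by rewrite -rmorphXn -rmorphM exprMn mulrAC.
      by rewrite /a /F exprD; ring.
    rewrite Normc.normcM (Normc.normcM (y x ^+ j)) normc_expiM.
    rewrite (Normc.normcM b) b0 exprD (Normc.normcM (_ * _)) (Normc.normcM (y x ^+ j)).
    rewrite (_ : _ * (_ * _ * _) = 2 * (`|h| ^+ K * normc (y x ^+ K)) *
      (normc (y x ^+ j) * normc (f x))); last by ring.
    rewrite ler_wpM2r ?mulr_ge0 ?normc_ge0//.
    by rewrite normcX normc_real -exprMn -normrM; exact: cexp_taylor.
  rewrite cLnormZ// b0.
  rewrite (_ : _ * (2 * _ * _) = 2 * `|h| ^+ K * (C * fine B * \prod_(i < j + K) m i)); last by ring.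
  by rewrite [X in (_ <= X)%E]EFinM; apply: lee_wpmul2l => //; rewrite lee_fin mulr_ge0// exprn_ge0.
have near0 : Lp_near mu k%:R V 0 (F 0%N t).
  move=> e e0; have e2 : 0 < e / 2 by rewrite divr_gt0.
  have [g Vg hg] := main 0%N t _ e2 _ e2; exists g => //.
  by rewrite add0r (_ : e = e / 2 + e / 2)//; lra.
have := near0; congr Lp_near; apply/funext => x.
by rewrite /F expr0 mul1r.
Qed.

(** Moving along the next direction requires the closure to contain all (v_i, x)^j multiples of what
    has been reached. Carrying every polynomial factor P through the induction provides them. *)
Lemma Lp_near_expi (I : Type) (s : seq I) (v : I -> 'rV[R]_n) (t : I -> R) (g : T -> R[i]) :
  (forall i, moment_majorant mu (v i)) -> tempered g ->
  (forall P, Lp_near mu k%:R V 0 (fun x => poly_fun P x * g x)) ->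
  forall P, Lp_near mu k%:R V 0
    (fun x => expi (\sum_(i <- s) t i *: v i) x * (poly_fun P x * g x)).
Proof.
move=> hm hg h0; elim: s => [|i s IH] P.
  rewrite big_nil; have := h0 P; congr Lp_near; apply/funext => x.
  by rewrite expi0 mul1r.
rewrite big_cons.
have tP : tempered (fun x => expi (\sum_(i <- s) t i *: v i) x * (poly_fun P x * g x)).
  by apply: temperedM; [exact: tempered_expi|apply: temperedM => //; exact: tempered_poly_fun].
have : Lp_near mu k%:R V 0 (fun x => expi (t i *: v i) x *
    (expi (\sum_(i <- s) t i *: v i) x * (poly_fun P x * g x))).
  apply: quasianalytic_transport => // j; have [Q hQ] := poly_inner_pow (v i) j.
  have := IH (Q * P); congr Lp_near; apply/funext => x.
  by rewrite poly_funM hQ; ring.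
by congr Lp_near; apply/funext => x; rewrite expiD mulrA.
Qed.

End Step.

(** * Density of trigonometric polynomials *)

Section ComplexSpan.
Context {R : realType} {d : measure_display} {T : measurableType d}.
Implicit Types (F : set (T -> R[i])).

Lemma cspan_gen F f : F f -> cspan F f.
Proof.
move=> Ff; exists 1%N, (fun=> 1), (fun=> f); split => //.
by apply/funext => x; rewrite big_ord1 mul1r.
Qed.

Lemma cspan0 F : cspan F (fun=> 0).
Proof.
exists 0%N, (fun=> 0), (fun=> fun=> 0); split; first by case.
by apply/funext => x; rewrite big_ord0.
Qed.

Lemma cspanD F f g : cspan F f -> cspan F g -> cspan F (fun x => f x + g x).
Proof.
move=> [k [c [u [hu ->]]]] [l [e [w [hw ->]]]].
exists (k + l)%N, (fun i : 'I_(k + l) => match fintype.split i with inl j => c j | inr j => e j end),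
  (fun i : 'I_(k + l) => match fintype.split i with inl j => u j | inr j => w j end); split.
  by move=> i; case: (fintype.split i).
apply/funext => x; rewrite big_split_ord/=; congr (_ + _).
  apply: eq_bigr => i _; case: splitP => [j /= /val_inj <-//|j /= E].
  by have := ltn_ord i; rewrite E -ltn_subRL subnn.
apply: eq_bigr => i _; case: splitP => [j /= E|j /= /addnI /val_inj <-//].
by have := ltn_ord j; rewrite -E -ltn_subRL subnn.
Qed.

Lemma cspanZ F a f : cspan F f -> cspan F (fun x => a * f x).
Proof.
move=> [k [c [u [hu ->]]]]; exists k, (fun i => a * c i), u; split => //.
by apply/funext => x; rewrite mulr_sumr; apply: eq_bigr => i _; rewrite mulrA.
Qed.

Lemma cspan_ind F (Q : set (T -> R[i])) : Q (fun=> 0) ->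
  (forall f g, Q f -> Q g -> Q (fun x => f x + g x)) ->
  (forall a f, F f -> Q (fun x => a * f x)) -> cspan F `<=` Q.
Proof.
move=> Q0 QD QZ _ [k [c [u [hu ->]]]].
elim: k c u hu => [|k IH] c u hu.
  by have := Q0; congr Q; apply/funext => x; rewrite big_ord0.
under eq_fun do rewrite big_ord_recr/=.
apply: QD; last exact: QZ.
by apply: (IH (fun i => c (widen_ord (leqnSn k) i)) (fun i => u (widen_ord (leqnSn k) i))).
Qed.

Lemma cspan_subspace F : F `<=` cmeasurable -> measurable_subspace (cspan F).
Proof.
move=> mF; split; [exact: cspan0|exact: cspanD|exact: cspanZ|].
apply: cspan_ind; first exact: cmeasurable_cst.
  by move=> f g; exact: cmeasurableD.
by move=> a f /mF; exact: cmeasurableZ.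
Qed.

End ComplexSpan.

(** The Newton-Schulz iteration for the sign. Its iterates are polynomials, so they stay in an
    algebra, and on [-1, 1] they are bounded by 1 and converge pointwise to the sign. *)
Definition sgn_step {R : realType} (x : R) : R := x * (3 - x ^+ 2) / 2.

Lemma sgn_step_bound {R : realType} (x : R) : `|x| <= 1 -> `|sgn_step x| <= 1.
Proof.
rewrite !ler_norml => /andP[h1 h2]; apply/andP; split; rewrite -subr_ge0.
  (* The cubic has its critical points at -1 and 1, which gives the double zeros. *)
  rewrite (_ : _ - _ = (x + 1) ^+ 2 * (2 - x) / 2); last by rewrite /sgn_step; field.
  by rewrite divr_ge0// mulr_ge0 ?sqr_ge0//; lra.
rewrite (_ : _ - _ = (1 - x) ^+ 2 * (2 + x) / 2); last by rewrite /sgn_step; field.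
by rewrite divr_ge0// mulr_ge0 ?sqr_ge0//; lra.
Qed.

Lemma iter_sgn_step_bound {R : realType} (x : R) k :
  `|x| <= 1 -> `|iter k sgn_step x| <= 1.
Proof. by move=> x1; elim: k => //= k IH; exact: sgn_step_bound. Qed.

(* On [(0, 1]] the error [1 - x] is multiplied by [(1 - x) (2 + x) / 2 <= 1 - x / 2]. *)
Lemma iter_sgn_step_error {R : realType} (x : R) k : 0 < x <= 1 ->
  x <= iter k sgn_step x <= 1 /\ 1 - iter k sgn_step x <= (1 - x / 2) ^+ k.
Proof.
move=> /andP[x0 x1]; elim: k => [|k [/andP[IH1 IH2] IH3]] /=.
  by rewrite lexx x1 expr0; split => //; lra.
set y := iter k sgn_step x in IH1 IH2 IH3 *.
have E : 1 - sgn_step y = (1 - y) * ((1 - y) * (2 + y) / 2) by rewrite /sgn_step; field.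
have F : (1 - y) * (2 + y) / 2 <= 1 - x / 2 by nra.
have G : 0 <= (1 - y) * (2 + y) / 2 by rewrite divr_ge0// mulr_ge0//; lra.
split; last first.
  by rewrite E exprSr; apply: ler_pM => //; rewrite subr_ge0.
have : 0 <= 1 - sgn_step y by rewrite E mulr_ge0// subr_ge0.
by have : y <= sgn_step y; [rewrite /sgn_step; nra|move=> *; apply/andP; split; lra].
Qed.

Lemma iter_sgn_stepN {R : realType} (x : R) k : iter k sgn_step (- x) = - iter k sgn_step x.
Proof. by elim: k => //= k ->; rewrite /sgn_step sqrrN !mulNr. Qed.

Lemma iter_sgn_step_cvg {R : realType} (x : R) : `|x| <= 1 ->
  iter k sgn_step x @[k --> \oo] --> Num.sg x.
Proof.
have pos (y : R) : 0 < y <= 1 -> iter k sgn_step y @[k --> \oo] --> (1 : R).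
  move=> y01; have /andP[y0 y1] := y01.
  apply: cvg_zero; apply/cvgr0Pnorm_lt => e e0.
  have y2 : `|1 - y / 2| < 1 by rewrite ger0_norm; lra.
  have /cvgr0Pnorm_lt /(_ _ e0) := cvg_geometric 1 y2.
  apply: filterS => k; rewrite /geometric/= mul1r => /(le_lt_trans (ler_norm _)).
  apply: le_lt_trans; have [/andP[_ h] h2] := iter_sgn_step_error k y01.
  by rewrite -normrN opprB ger0_norm ?subr_ge0.
have [x0|x0|->] := ltgtP x 0 => x1.
- rewrite ltr0_sg//; rewrite ltr0_norm// in x1.
  have -> : (fun k => iter k sgn_step x) = (fun k => - iter k sgn_step (- x)).
    by apply/funext => k; rewrite iter_sgn_stepN opprK.
  by apply: cvgN; apply: pos; rewrite oppr_gt0 x0.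
- by rewrite gtr0_sg//; apply: pos; rewrite x0 -(gtr0_norm x0).
- rewrite sgr0; have -> : (fun k => iter k sgn_step (0 : R)) = (fun=> 0).
    by apply/funext; elim => //= k ->; rewrite /sgn_step !mul0r.
  exact: cvg_cst.
Qed.

Section TrigDensity.
Context {R : realType} {n : nat}.
Local Notation T := (borelRn R n).
Variables (mu : {measure set T -> \bar R}) (p : R).
Hypotheses (mufin : (mu setT < +oo)%E) (p1 : 1 <= p).
Local Notation W := (cspan (@expi R n @` setT)).

Let p0 : 0 < p. Proof. exact: lt_le_trans p1. Qed.

Lemma trig_subspace : measurable_subspace W.
Proof. by apply: cspan_subspace => _ [l _ <-]; have [] := tempered_expi l. Qed.

Lemma trigM f g : W f -> W g -> W (fun x => f x * g x).
Proof.
move=> Wf Wg; move: f Wf; apply: cspan_ind.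
- by under eq_fun do rewrite mul0r; exact: cspan0.
- by move=> f h Wf Wh; under eq_fun do rewrite mulrDl; exact: cspanD.
move=> a _ [l _ <-]; move: g Wg; apply: cspan_ind.
- by under eq_fun do rewrite mulr0; exact: cspan0.
- by move=> f h Wf Wh; under eq_fun do rewrite mulrDr; exact: cspanD.
move=> b _ [m _ <-].
have -> : (fun x => a * expi l x * (b * expi m x)) = (fun x : T => a * b * expi (l + m) x).
  by apply/funext => x; rewrite expiD; ring.
by apply: cspanZ; apply: cspan_gen; exists (l + m).
Qed.

Lemma trig_bounded f : W f -> exists A, forall x, normc (f x) <= A.
Proof.
move: f; apply: cspan_ind.
- by exists 0 => x; rewrite Normc.normc0.
- move=> f g [A hA] [B hB]; exists (A + B) => x.
  by rewrite (le_trans (le_normcD _ _))// lerD.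
- by move=> a _ [l _ <-]; exists (normc a) => x; rewrite Normc.normcM normc_expi mulr1.
Qed.

(** Boundedness is included since the L_p closure alone is not stable under products. *)
Definition trig_closure (f : T -> R[i]) : Prop :=
  [/\ cmeasurable f, exists A, forall x, normc (f x) <= A & Lp_near mu p W 0 f].

Lemma trig_closure_trig f : W f -> trig_closure f.
Proof.
move=> Wf; split; [exact: (subspace_measurable trig_subspace)|exact: trig_bounded|].
exact: (Lp_near_subspace _ p1).
Qed.

Lemma trig_closureD f g : trig_closure f -> trig_closure g ->
  trig_closure (fun x => f x + g x).
Proof.
move=> [mf [A hA] hf] [mg [B hB] hg]; split; first exact: cmeasurableD.
  by exists (A + B) => x; rewrite (le_trans (le_normcD _ _))// lerD.
by have := Lp_nearD p1 trig_subspace mf mg hf hg; rewrite addr0.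
Qed.

Lemma trig_closureZ a f : trig_closure f -> trig_closure (fun x => a * f x).
Proof.
move=> [mf [A hA] hf]; split; first exact: cmeasurableZ.
  by exists (normc a * A) => x; rewrite Normc.normcM ler_wpM2l ?normc_ge0.
by have := Lp_nearZ p1 trig_subspace a mf hf; rewrite mulr0.
Qed.

Lemma trig_closureM f g : trig_closure f -> trig_closure g ->
  trig_closure (fun x => f x * g x).
Proof.
move=> [mf [A hA] hf] [mg [B hB] hg]; split; first exact: cmeasurableM.
  by exists (A * B) => x; rewrite Normc.normcM ler_pM ?normc_ge0.
move=> e e0; rewrite add0r.
have bnd (h : T -> R[i]) (u : T -> R[i]) D : cmeasurable h -> cmeasurable u ->
    (forall x, normc (h x) <= D) ->
    (cLnorm mu p (fun x => h x * u x)%R <= (`|D| + 1)%:E * cLnorm mu p u)%E.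
  move=> mh mu' hD.
  have nb : normc (real_complex _ (`|D| + 1)) = `|D| + 1.
    by rewrite normc_real [LHS]ger0_norm// addr_ge0.
  have := cLnormZ mu (real_complex _ (`|D| + 1)) p0 mu'; rewrite nb => <-.
  apply: le_cLnorm => //; [exact: cmeasurableM|exact: cmeasurableZ|move=> x].
  rewrite !Normc.normcM nb ler_wpM2r ?normc_ge0//.
  by rewrite (le_trans (hD x))// (le_trans (ler_norm _))// lerDl.
have e2 : 0 < e / 2 by rewrite divr_gt0.
have B1 : 0 < `|B| + 1 by rewrite ltr_wpDl.
(* The order matters: f' is chosen against the bound B of g, and only then g' against a bound of f',
   since the approximants have no common bound. *)
have [f' Wf'] := hf _ (divr_gt0 e2 B1); rewrite add0r => ff'.
have [A' hA'] := trig_bounded Wf'.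
have A1 : 0 < `|A'| + 1 by rewrite ltr_wpDl.
have [g' Wg'] := hg _ (divr_gt0 e2 A1); rewrite add0r => gg'.
exists (fun x => f' x * g' x); first exact: trigM.
have mf' := subspace_measurable trig_subspace Wf'.
have mg' := subspace_measurable trig_subspace Wg'.
have -> : (fun x => f x * g x - f' x * g' x) =
    (fun x => g x * (f x - f' x) + f' x * (g x - g' x)).
  by apply/funext => x; ring.
have mff := cmeasurableB mf mf'; have mgg := cmeasurableB mg mg'.
apply: (le_lt_trans (cLnormD mu p1 (cmeasurableM mg mff) (cmeasurableM mf' mgg))).
have -> : e = e / 2 + e / 2 by lra.
rewrite EFinD; apply: lteD.
  apply: (le_lt_trans (bnd _ _ _ mg mff hB)).
  by rewrite muleC -lte_pdivlMr// -EFinM.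
apply: (le_lt_trans (bnd _ _ _ mf' mgg hA')).
by rewrite muleC -lte_pdivlMr// -EFinM.
Qed.

(** Dominated convergence with the constant 2A, which is in L_p because mu is finite. *)
Lemma trig_closure_lim (h : nat -> T -> R[i]) f A :
  (forall k, trig_closure (h k)) -> cmeasurable f ->
  (forall k x, normc (h k x) <= A) -> (forall x, normc (f x) <= A) ->
  (forall x, normc (f x - h k x) @[k --> \oo] --> (0 : R)) -> trig_closure f.
Proof.
move=> hh mf hA fA hlim; split => //; first by exists A.
apply: (Lp_near_approx p1 trig_subspace mf) => e e0.
have mh k : cmeasurable (h k) by have [] := hh k.
have [//|||||k hk] := @cLnorm_dominated _ _ _ mu p (fun k x => f x - h k x)
  (fun=> real_complex _ (A + A)) p0 _ _ _ _ _ e e0.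
- by move=> k; exact: cmeasurableB.
- exact: cmeasurable_cst.
- rewrite cLnorm_cst//; apply: lte_mul_pinfty => //; first by rewrite lee_fin normc_ge0.
  exact: poweR_lty.
- move=> k x; rewrite normc_real (le_trans _ (ler_norm _))//.
  by rewrite (le_trans (le_normcD _ _))// normcN lerD.
- exact: hlim.
by exists (h k); split => //; have [] := hh k.
Qed.

Definition trig_closure_real (r : T -> R) := trig_closure (fun x => real_complex _ (r x)).

Lemma trig_closure_real_measurable r : trig_closure_real r -> measurable_fun setT r.
Proof. by move=> [[]]. Qed.

Lemma trig_closure_realD r s : trig_closure_real r -> trig_closure_real s ->
  trig_closure_real (fun x => r x + s x).
Proof.
move=> hr hs; rewrite /trig_closure_real; under eq_fun do rewrite rmorphD.
exact: trig_closureD.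
Qed.

Lemma trig_closure_realM r s : trig_closure_real r -> trig_closure_real s ->
  trig_closure_real (fun x => r x * s x).
Proof.
move=> hr hs; rewrite /trig_closure_real; under eq_fun do rewrite rmorphM.
exact: trig_closureM.
Qed.

Lemma trig_closure_real_cst a : trig_closure_real (fun=> a).
Proof.
apply: trig_closure_trig; have -> : (fun=> real_complex _ a) =
    (fun x : T => real_complex _ a * expi 0 x).
  by apply/funext => x; rewrite expi0 mulr1.
by apply: cspanZ; apply: cspan_gen; exists 0.
Qed.

Lemma trig_closure_realZ a r : trig_closure_real r -> trig_closure_real (fun x => a * r x).
Proof. by move=> hr; apply: trig_closure_realM => //; exact: trig_closure_real_cst. Qed.

Lemma trig_closure_real_lim (h : nat -> T -> R) r A :
  (forall k, trig_closure_real (h k)) -> (forall k x, `|h k x| <= A) ->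
  (forall x, h k x @[k --> \oo] --> r x) -> trig_closure_real r.
Proof.
move=> hh hA hlim; apply: (@trig_closure_lim (fun k x => real_complex _ (h k x)) _ A) => //.
- apply: cmeasurable_real; apply: (measurable_fun_cvg (h := h)) => //.
  by move=> k; exact: trig_closure_real_measurable.
- by move=> k x; rewrite normc_real.
- move=> x; rewrite normc_real.
  have c : `|h k x| @[k --> \oo] --> `|r x| by apply: cvg_norm; exact: hlim.
  rewrite -(cvg_lim (@Rhausdorff R) c); apply: limr_le; last exact: nearW.
  by apply/cvg_ex; exists `|r x|.
- move=> x; under eq_fun do rewrite -rmorphB normc_real.
  apply/norm_cvg0P; rewrite -(subrr (r x)).
  by apply: cvgB; [exact: cvg_cst|exact: hlim].
Qed.

Lemma trig_closure_real_cos l : trig_closure_real (fun x => cos (inner l x)).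
Proof.
apply: trig_closure_trig.
have -> : (fun x : T => real_complex _ (cos (inner l x))) =
    (fun x => real_complex _ 2^-1 * expi l x + real_complex _ 2^-1 * expi (- l) x).
  apply/funext => x; rewrite -mulrDr /expi !cexp_i innerN cosN sinN.
  by apply/eqP; rewrite eq_complex/=; apply/andP; split; apply/eqP; field.
by apply: cspanD; apply: cspanZ; apply: cspan_gen; eexists.
Qed.

Lemma trig_closure_real_sin l : trig_closure_real (fun x => sin (inner l x)).
Proof.
apply: trig_closure_trig.
have -> : (fun x : T => real_complex _ (sin (inner l x))) =
    (fun x => Complex 0 (- 2^-1) * expi l x + Complex 0 2^-1 * expi (- l) x).
  apply/funext => x; rewrite /expi !cexp_i innerN cosN sinN.
  by apply/eqP; rewrite eq_complex/=; apply/andP; split; apply/eqP; field.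
by apply: cspanD; apply: cspanZ; apply: cspan_gen; eexists.
Qed.

Lemma trig_closure_real_sg r : trig_closure_real r -> (forall x, `|r x| <= 1) ->
  trig_closure_real (fun x => Num.sg (r x)).
Proof.
move=> hr r1.
apply: (@trig_closure_real_lim (fun k x => iter k sgn_step (r x)) _ 1).
- elim=> [//|k IH].
  have -> : (fun x => iter k.+1 sgn_step (r x)) = (fun x => 2^-1 *
      (iter k sgn_step (r x) * (3 + -1 * (iter k sgn_step (r x) * iter k sgn_step (r x))))).
    by apply/funext => x; rewrite /= /sgn_step; field.
  apply: trig_closure_realZ; apply: trig_closure_realM => //.
  apply: trig_closure_realD; first exact: trig_closure_real_cst.
  by apply: trig_closure_realZ; exact: trig_closure_realM.
- by move=> k x; exact: iter_sgn_step_bound.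
- by move=> x; exact: iter_sgn_step_cvg.
Qed.

Lemma sg_sin (z : R) : `|z| < pi -> Num.sg (sin z) = Num.sg z.
Proof.
have [z0|z0|->] := ltgtP z 0 => hz; last by rewrite sin0.
  rewrite ltr0_norm// in hz.
  by rewrite !ltr0_sg// -oppr_gt0 -sinN sin_gt0_pi// oppr_gt0 z0.
by rewrite gtr0_norm// in hz; rewrite !gtr0_sg// sin_gt0_pi// z0.
Qed.

(** The affine function z is unbounded, but sin(z / (k+1)) is a trigonometric polynomial bounded by
    1, and it has the sign of z as soon as |z| / (k+1) < pi. *)
Lemma trig_closure_real_sg_affine l a :
  trig_closure_real (fun x => Num.sg (inner l x - a)).
Proof.
apply: (@trig_closure_real_lim (fun k x => Num.sg (sin (k.+1%:R^-1 * (inner l x - a)))) _ 1).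
- move=> k; apply: trig_closure_real_sg; last by move=> x; exact: sin_max.
  have -> : (fun x => sin (k.+1%:R^-1 * (inner l x - a))) = (fun x : T =>
      cos (k.+1%:R^-1 * a) * sin (inner (k.+1%:R^-1 *: l) x) +
      (- sin (k.+1%:R^-1 * a)) * cos (inner (k.+1%:R^-1 *: l) x)).
    by apply/funext => x; rewrite mulrBr sinB innerZl mulNr mulrC [cos _ * sin (_ * a)]mulrC.
  apply: trig_closure_realD; apply: trig_closure_realZ.
    exact: trig_closure_real_sin.
  exact: trig_closure_real_cos.
- by move=> k x; rewrite normr_sg; case: eqP.
move=> x; set z := inner l x - a.
apply: cvg_near_cst; exists (Num.truncn (`|z| / pi)).+1 => // k /= hk.
have k1 : 0 < k.+1%:R :> R by rewrite ltr0n.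
have zk : `|k.+1%:R^-1 * z| < pi.
  rewrite normrM ger0_norm ?invr_ge0// mulrC ltr_pdivrMr// mulrC -ltr_pdivrMr ?pi_gt0//.
  by apply: (lt_trans (truncnS_gt _)); rewrite ltr_nat.
by rewrite sg_sin// sgrM gtr0_sg ?invr_gt0// mul1r.
Qed.

Lemma trig_closure_indic_gt l a : trig_closure_real (\1_[set x : T | a < inner l x]).
Proof.
have hs := trig_closure_real_sg_affine l a.
(* (s^2 + s) / 2 is 1 at s = 1 and 0 at s = 0 and s = -1. *)
have -> : \1_[set x : T | a < inner l x] = (fun x => 2^-1 *
    (Num.sg (inner l x - a) * Num.sg (inner l x - a) + Num.sg (inner l x - a))) :> (T -> R).
  apply/funext => x; rewrite indicE.
  have [h|h|h] := ltgtP a (inner l x).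
  - by rewrite mem_set// gtr0_sg ?subr_gt0//=; field.
  - rewrite memNset /= ?ltr0_sg ?subr_lt0//; first by ring.
    by apply/negP; rewrite -leNgt ltW.
  - by rewrite memNset /= ?h ?subrr ?sgr0 ?ltxx//; ring.
by apply: trig_closure_realZ; apply: trig_closure_realD => //; exact: trig_closure_realM.
Qed.

Lemma trig_closure_indicC (A : set T) :
  trig_closure_real (\1_A) -> trig_closure_real (\1_(~` A)).
Proof.
move=> hA; have -> : \1_(~` A) = (fun x => 1 + -1 * \1_A x) :> (T -> R).
  by apply/funext => x; rewrite !indicE in_setC; case: (x \in A) => /=; ring.
by apply: trig_closure_realD; [exact: trig_closure_real_cst|exact: trig_closure_realZ].
Qed.

Lemma trig_closure_indicI (A B : set T) : trig_closure_real (\1_A) ->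
  trig_closure_real (\1_B) -> trig_closure_real (\1_(A `&` B)).
Proof.
move=> hA hB; have -> : \1_(A `&` B) = (fun x => \1_A x * \1_B x) :> (T -> R).
  by apply/funext => x; rewrite indicI.
exact: trig_closure_realM.
Qed.

Lemma trig_closure_indic0 : trig_closure_real (\1_(set0 : set T)).
Proof.
have -> : \1_(set0 : set T) = (fun=> 0) :> (T -> R) by rewrite indic0.
exact: trig_closure_real_cst.
Qed.

Lemma trig_closure_indicU (A B : set T) : trig_closure_real (\1_A) ->
  trig_closure_real (\1_B) -> trig_closure_real (\1_(A `|` B)).
Proof.
move=> hA hB; rewrite -[A `|` B]setCK setCU; apply: trig_closure_indicC.
by apply: trig_closure_indicI; exact: trig_closure_indicC.
Qed.

Lemma trig_closure_sigma_algebra :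
  sigma_algebra setT [set A : set T | trig_closure_real (\1_A)].
Proof.
split => /=; first exact: trig_closure_indic0.
  by move=> A hA; rewrite setTD; exact: trig_closure_indicC.
move=> A hA; apply: (@trig_closure_real_lim (fun k => \1_(\big[setU/set0]_(i < k) A i)) _ 1).
- elim=> [|k IH]; first by rewrite big_ord0; exact: trig_closure_indic0.
  by rewrite big_ord_recr/=; exact: trig_closure_indicU.
- by move=> k x; rewrite indicE; case: (_ \in _); rewrite /= ?normr1 ?normr0.
move=> x; apply: cvg_near_cst.
have [[i _ Ax]|nA] := pselect ((\bigcup_k A k) x).
  exists i.+1 => // k /= ik; rewrite !indicE !mem_set//; first by exists i.
  by rewrite -bigcup_mkord; exists i.
exists 0%N => // k _; rewrite !indicE !memNset// -bigcup_mkord => -[i _ Ax].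
by apply: nA; exists i.
Qed.

Lemma ltr_dist_halfspaces (a b c : R) :
  `|b - a| < c <-> a - c < b /\ - a - c < - b.
Proof.
rewrite ltr_norml; split => [/andP[h1 h2]|[h1 h2]]; first by split; lra.
by apply/andP; split; lra.
Qed.

(** A countable base of the topology whose members are finite intersections of half-spaces. *)
Definition rat_box (q : 'rV[rat]_n) (k : nat) : set T :=
  [set x | forall j, `|(x : 'rV[R]_n) ord0 j - ratr (q ord0 j)| < k.+1%:R^-1].

Lemma inner_delta (x : 'rV[R]_n) j : inner (delta_mx ord0 j) x = x ord0 j.
Proof.
rewrite /inner (bigD1 j)//= mxE !eqxx mul1r big1 ?addr0// => i ij.
by rewrite mxE (negbTE ij) andbF mul0r.
Qed.

Lemma trig_closure_rat_box q k : trig_closure_real (\1_(rat_box q k)).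
Proof.
pose A j := [set x : T | ratr (q ord0 j) - k.+1%:R^-1 < inner (delta_mx ord0 j) x].
pose B j := [set x : T | - ratr (q ord0 j) - k.+1%:R^-1 < inner (- delta_mx ord0 j) x].
have -> : rat_box q k = \big[setI/setT]_(j <- index_enum 'I_n) (A j `&` B j).
  rewrite -bigcap_seq; apply/seteqP; split => x /= h j.
    by move=> _; rewrite /A /B /= innerN inner_delta; exact/ltr_dist_halfspaces.
  have [] := h j (mem_index_enum j); rewrite /A /B /= innerN inner_delta => h1 h2.
  exact/ltr_dist_halfspaces.
elim: (index_enum _) => [|j s IH].
  rewrite big_nil -setC0; apply: trig_closure_indicC; exact: trig_closure_indic0.
rewrite big_cons; apply: trig_closure_indicI => //.
by apply: trig_closure_indicI; exact: trig_closure_indic_gt.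
Qed.

Lemma trig_closure_indic_open (U : set T) :
  @open 'rV[R]_n U -> trig_closure_real (\1_U).
Proof.
move=> oU; have [_ _ sU] := trig_closure_sigma_algebra.
(* An enumeration of the boxes inside U; codes of no pair, and boxes that leave U, yield the empty
   set. *)
pose C m : set T := if (unpickle m : option ('rV[rat]_n * nat)) is Some (q, k) then
  (if `[< rat_box q k `<=` U >] then rat_box q k else set0) else set0.
have -> : U = \bigcup_m C m.
  apply/seteqP; split => x; last first.
    move=> [m _]; rewrite /C; case: (unpickle m) => [[q k]|//].
    by case: asboolP => // h /h.
  move=> Ux; have /nbhs_ballP[e /= e0 he] : nbhs (x : 'rV[R]_n) U by exact: open_nbhs_nbhs.
  (* If each coordinate of q is within 1/(k+1) of that of x, every point of the box is within
     2/(k+1) < e of x in the sup norm. *)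
  pose k := Num.truncn (2 / e).
  have k1 : 0 < k.+1%:R :> R by rewrite ltr0n.
  have ke : 2 * k.+1%:R^-1 < e.
    by rewrite ltr_pdivrMr// mulrC -ltr_pdivrMr// truncnS_gt.
  have hq j : {q : rat | `|(x : 'rV[R]_n) ord0 j - ratr q| < k.+1%:R^-1}.
    apply: cid; have d0 : 0 < k.+1%:R^-1 :> R by rewrite invr_gt0.
    have xx : x ord0 j - k.+1%:R^-1 < x ord0 j + k.+1%:R^-1.
      by apply: (@lt_trans _ _ (x ord0 j)); rewrite ?ltrBlDr ltrDl.
    have [q] := rat_in_itvoo xx; rewrite in_itv/= => /andP[q1 q2]; exists q.
    rewrite distrC ltr_norml; apply/andP; split; last by rewrite ltrBlDl.
    by rewrite ltrNl opprB ltrBlDr -ltrBlDl.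
  pose q : 'rV[rat]_n := \row_j sval (hq j).
  exists (pickle (q, k)) => //; rewrite /C pickleK.
  case: asboolP => [_ j|]; first by rewrite mxE; exact: (svalP (hq j)).
  case => y hy; apply: he; split => // i j; rewrite (ord1 i).
  rewrite /ball/=; have := hy j; rewrite mxE => h1; have h2 := svalP (hq j).
  rewrite (_ : x ord0 j - y ord0 j = (x ord0 j - ratr (sval (hq j))) -
    (y ord0 j - ratr (sval (hq j)))); last by ring.
  apply: (le_lt_trans (ler_normB _ _)); apply: lt_trans ke.
  by rewrite mulr_natl mulr2n ltrD.
apply: sU => m; rewrite /C /=; case: (unpickle m) => [[q k]|]; last exact: trig_closure_indic0.
by case: asboolP => _; [exact: trig_closure_rat_box|exact: trig_closure_indic0].
Qed.

Lemma trig_closure_indic (A : set T) : measurable A -> trig_closure_real (\1_A).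
Proof.
move: A; apply: smallest_sub; first exact: trig_closure_sigma_algebra.
exact: trig_closure_indic_open.
Qed.

Lemma trig_closure_real_sum k (F : 'I_k -> T -> R) :
  (forall i, trig_closure_real (F i)) -> trig_closure_real (fun x => \sum_(i < k) F i x).
Proof.
elim: k F => [|k IH] F hF.
  by under eq_fun do rewrite big_ord0; exact: trig_closure_real_cst.
by under eq_fun do rewrite big_ord_recr; apply: trig_closure_realD => //; exact: IH.
Qed.

Lemma trig_closure_real_bounded (r : T -> R) A : measurable_fun setT r ->
  (forall x, `|r x| <= A) -> trig_closure_real r.
Proof.
(* The shift makes the function nonnegative, so that it is the limit of an increasing sequence of
   simple functions. *)
move=> mr rA; pose s x := r x + A.
have s0 x : 0 <= s x by have := rA x; rewrite ler_norml /s => /andP[]; lra.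
have ms : measurable_fun setT (EFin \o s).
  by apply/measurable_EFinP; exact: measurable_funD.
suff hs : trig_closure_real s.
  have := trig_closure_realD hs (trig_closure_real_cst (- A)).
  by congr trig_closure_real; apply/funext => x; rewrite /s addrK.
apply: (@trig_closure_real_lim (fun k x => nnsfun_approx measurableT ms k x) s (A + A)).
- move=> k; pose g := nnsfun_approx measurableT ms k.
  have -> : (g : T -> R) = _ := funext (fimfunEord g).
  apply: trig_closure_real_sum => i; apply: trig_closure_realZ.
  by apply: trig_closure_indic; exact: measurable_sfunP.
- move=> k x; rewrite ger0_norm// nnsfun_approxE -lee_fin.
  apply: (@le_trans _ _ (s x)%:E); first by apply: le_approx => // y _; rewrite lee_fin.
  by rewrite lee_fin lerD2r (le_trans (ler_norm _)).
- move=> x; have := @cvg_nnsfun_approx _ _ _ _ measurableT _ ms (fun x _ => s0 x) x I.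
  by move=> /fine_cvg.
Qed.

(** f is replaced by 0 where |f| > k, with an error dominated by f; the real and imaginary parts of
    the truncation are bounded and measurable. *)
Lemma Lp_near_trig f : Lp mu p f -> Lp_near mu p W 0 f.
Proof.
move=> [mf fp]; apply: (Lp_near_approx p1 trig_subspace mf) => e e0.
have mnf := measurable_normc mf.
pose B k := [set x | normc (f x) <= k%:R].
have mB k : measurable (B k).
  by rewrite -[B k]setTI; apply: measurable_fun_le => //; exact: measurable_cst.
pose h k x := f x * real_complex _ (\1_(B k) x).
have m1 k : cmeasurable (fun x => real_complex _ (\1_(B k) x)).
  by apply: cmeasurable_real; exact: measurable_indic.
have mh k : cmeasurable (h k) by exact: cmeasurableM.
have h1 k x : B k x -> h k x = f x by move=> Bx; rewrite /h indicE mem_set// mulr1.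
have h0 k x : ~ B k x -> h k x = 0 by move=> Bx; rewrite /h indicE memNset// mulr0.
have [|||k hk] := @cLnorm_dominated _ _ _ mu p (fun k x => f x - h k x) f p0 _ mf fp _ _ e e0.
- by move=> k; exact: cmeasurableB.
- move=> k x; have [Bx|Bx] := pselect (B k x).
    by rewrite h1// subrr Normc.normc0 normc_ge0.
  by rewrite h0// subr0.
- move=> x; apply: cvg_near_cst; exists (Num.truncn (normc (f x))).+1 => // k /= kx.
  rewrite h1 ?subrr ?Normc.normc0// /B/=.
  by apply: (le_trans (ltW (truncnS_gt _))); rewrite ler_nat.
exists (h k); split => //.
have [mre mim] := mh k.
have hb x : normc (h k x) <= k%:R.
  by have [Bx|Bx] := pselect (B k x); [rewrite h1|rewrite h0// Normc.normc0].
have hre := trig_closure_real_bounded mre (fun x => le_trans (Re_le_normc _) (hb x)).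
have him := trig_closure_real_bounded mim (fun x => le_trans (Im_le_normc _) (hb x)).
have [_ _] := trig_closureD hre (trig_closureZ 'i%C him).
by congr Lp_near; apply/funext => x; rewrite [RHS]complexE.
Qed.

End TrigDensity.

(** * Exponentials with frequencies in a somewhere dense set *)

Section SomewhereDense.
Context {R : realType} {n : nat}.
Local Notation T := (borelRn R n).
Variables (mu : {measure set T -> \bar R}) (p : R) (S : set 'rV[R]_n).
Hypotheses (hmu : Mstar mu) (p1 : 1 <= p).
Local Notation V := (cspan (@expi R n @` S)).

Let p0 : 0 < p. Proof. exact: lt_le_trans p1. Qed.

Lemma cspan_expi_subspace : measurable_subspace V.
Proof. by apply: cspan_subspace => _ [l _ <-]; have [] := tempered_expi l. Qed.

Lemma normc_cexp_sub1 (u : R) : normc (cexp ('i%C * real_complex _ u) - 1) <= 2 * `|u|.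
Proof.
have := cexp_taylor 1 u.
by rewrite big_ord1 !expr0 fact0 divr1 mul1r expr1.
Qed.

Lemma normc_cexp_sub2 (u : R) :
  normc (cexp ('i%C * real_complex _ u) - 1 - 'i%C * real_complex _ u) <= 2 * `|u| ^+ 2.
Proof.
have := cexp_taylor 2 u; congr (normc _ <= _).
rewrite big_ord_recr big_ord1/= !expr0 !expr1 fact0 (_ : 1`! = 1%N)// !divr1 mul1r.
by rewrite -addrA -opprD.
Qed.

Lemma tempered_enorm : tempered (fun x : T => real_complex R (enorm x)).
Proof.
split; first by apply: cmeasurable_real; exact: measurable_enorm.
exists 1 => //; exists 1%N => x; rewrite normc_real mul1r expr1 ger0_norm ?enorm_ge0//.
by rewrite lerDr.
Qed.

Lemma Lp_near_expi_closure l : closure S l -> Lp_near mu p V 0 (expi l).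
Proof.
move=> Sl; have [ml _] := tempered_expi l.
apply: (Lp_near_approx p1 cspan_expi_subspace ml) => e e0.
have [mE _] := tempered_enorm.
set N := cLnorm mu p (fun x : T => real_complex R (enorm x)).
have Nfin : N \is a fin_num.
  by rewrite ge0_fin_numE ?cLnorm_ge0//; apply: tempered_Lp => //; exact: tempered_enorm.
have N0 : 0 <= fine N by rewrite fine_ge0// cLnorm_ge0.
have D0 : 0 < 2 * n%:R * fine N + 1 by rewrite ltr_wpDl// !mulr_ge0.
(* For m in the sup-norm ball of radius d around l, |(l - m, x)| is at most n d |x|; the 2 comes
   from [normc_cexp_sub1]. The 1 in the denominator covers N = 0. *)
have [d [d0 hd]] : exists d, 0 < d /\ 2 * n%:R * d * fine N < e.
  exists (e / (2 * n%:R * fine N + 1)); split; first by rewrite divr_gt0.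
  rewrite (_ : 2 * n%:R * (e / (2 * n%:R * fine N + 1)) * fine N =
      e * (2 * n%:R * fine N) / (2 * n%:R * fine N + 1)).
    by rewrite ltr_pdivrMr// ltr_pM2l// ltrDl.
  by field; rewrite gt_eqF.
have [m [Sm [_ hm]]] := Sl _ (nbhsx_ballx l d d0).
have [mm _] := tempered_expi m.
exists (expi m); split => //.
  by apply: (Lp_near_subspace _ p1); apply: cspan_gen; exists m.
pose c : R[i] := real_complex _ (2 * n%:R * d).
have nc : normc c = 2 * n%:R * d.
  by rewrite normc_real ger0_norm//; apply: mulr_ge0; [exact: mulr_ge0|exact: ltW].
apply: (@le_lt_trans _ _ (cLnorm mu p (fun x : T => c * real_complex _ (enorm x)))).
  apply: le_cLnorm => //; [exact: cmeasurableB|exact: cmeasurableZ|move=> x].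
  have -> : expi l x - expi m x =
      expi m x * (cexp ('i%C * real_complex _ (inner (l - m) x)) - 1).
    by rewrite mulrBr mulr1 -{1}(subrKC m l) expiD.
  rewrite normc_expiM (le_trans (normc_cexp_sub1 _))// Normc.normcM nc normc_real.
  rewrite [`|enorm x|]ger0_norm ?enorm_ge0// -!mulrA ler_wpM2l//.
  rewrite (le_trans (inner_le_enorm _ _))// [leRHS]mulrA ler_wpM2r ?enorm_ge0//.
  rewrite -[n in n%:R]card_ord mulr_natl -sumr_const.
  by apply: ler_sum => j _; rewrite !mxE; exact/ltW/(hm ord0 j).
by rewrite cLnormZ// -/N nc -(fineK Nfin) -EFinM lte_fin.
Qed.

(** Up to the factor i, multiplying by x_j differentiates q e_{il} with respect to l_j. The
    difference quotient uses a neighbouring frequency, so the induction ranges over all l of the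
    open set; it also carries [tempered q], which makes the error x_j^2 q an element of L_p. *)
Lemma Lp_near_poly_expi l P : interior (closure S) l ->
  Lp_near mu p V 0 (fun x => poly_fun P x * expi l x).
Proof.
move: l; suff [] : tempered (@poly_fun R n P) /\
    forall l, interior (closure S) l -> Lp_near mu p V 0 (fun x => poly_fun P x * expi l x).
  by [].
have mqe q l : tempered q -> cmeasurable (fun x : T => q x * expi l x).
  by move=> tq; have [] := temperedM tq (tempered_expi l).
apply: (@poly_fun_ind _ _ [set q | tempered q /\ forall l, interior (closure S) l ->
  Lp_near mu p V 0 (fun x => q x * expi l x)]) => /=.
- split; first exact: tempered_cst.
  move=> l /interior_subset /Lp_near_expi_closure; congr Lp_near.
  by apply/funext => x; rewrite mul1r.
- move=> f g [tf hf] [tg hg]; split; first exact: temperedD.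
  move=> l Sl; have := Lp_nearD p1 cspan_expi_subspace (mqe _ l tf) (mqe _ l tg) (hf l Sl) (hg l Sl).
  by rewrite addr0; congr Lp_near; apply/funext => x; rewrite mulrDl.
- move=> a f [tf hf]; split; first by apply: temperedM => //; exact: tempered_cst.
  move=> l Sl; have := Lp_nearZ p1 cspan_expi_subspace a (mqe _ l tf) (hf l Sl).
  by rewrite mulr0; congr Lp_near; apply/funext => x; rewrite mulrA.
move=> j q [tq hq]; have tX := tempered_coord (R := R) j.
split; first exact: temperedM.
move=> l Sl; have tXq := temperedM tX tq.
apply: (Lp_near_approx p1 cspan_expi_subspace (mqe _ l tXq)) => e e0.
pose y (x : T) : R := (x : 'rV[R]_n) ord0 j.
have tY : tempered (fun x => real_complex _ (y x) * (real_complex _ (y x) * q x)).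
  exact: temperedM.
have [mY _] := tY.
set N := cLnorm mu p (fun x => real_complex _ (y x) * (real_complex _ (y x) * q x)).
have Nfin : N \is a fin_num.
  by rewrite ge0_fin_numE ?cLnorm_ge0//; exact: tempered_Lp.
have N0 : 0 <= fine N by rewrite fine_ge0// cLnorm_ge0.
have /nbhs_ballP[r /= r0 hr] : nbhs l (interior (closure S)).
  by apply: open_nbhs_nbhs; split => //; exact: open_interior.
have D0 : 0 < 2 * fine N + 1 by rewrite ltr_wpDl// !mulr_ge0.
(* The first bound keeps the shifted frequency in the open set, the second makes the error 2 h N
   smaller than e. *)
pose h := Num.min (r / 2) (e / (2 * fine N + 1)).
have h0 : 0 < h by rewrite lt_min !divr_gt0.
have hh : 2 * h * fine N < e.
  apply: (@le_lt_trans _ _ (2 * (e / (2 * fine N + 1)) * fine N)).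
    by rewrite ler_wpM2r// ler_wpM2l// ge_min lexx orbT.
  rewrite (_ : 2 * _ * _ = e * (2 * fine N) / (2 * fine N + 1)); last first.
    by field; rewrite gt_eqF.
  by rewrite ltr_pdivrMr// ltr_pM2l// ltrDl.
pose l' := l + h *: delta_mx ord0 j.
have Sl' : interior (closure S) l'.
  apply: hr; split => // i k; rewrite /ball/= /l' !mxE opprD addrA subrr sub0r normrN.
  rewrite normrM (gtr0_norm h0).
  have hr2 : h < r.
    apply: (@le_lt_trans _ _ (r / 2)); first by rewrite ge_min lexx.
    by rewrite ltr_pdivrMr// ltr_pMr// ltr1n.
  apply: le_lt_trans hr2; rewrite ler_piMr ?(ltW h0)//.
  by case: (_ && _); rewrite ?normr1 ?normr0.
(* The linear term of e^(i h x_j) - 1 is i h x_j. *)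
pose b : R[i] := ('i%C * real_complex _ h)^-1.
pose g (x : T) := b * (q x * expi l' x) + (- b) * (q x * expi l x).
have mq := mqe q _ tq.
have hre : ('i%C * real_complex _ h : R[i]) != 0.
  by apply: mulf_neq0; rewrite eq_complex/= ?oner_eq0 ?andbF// negb_and (gt_eqF h0).
exists g; split.
- by apply: cmeasurableD; apply: cmeasurableZ.
- have := Lp_nearD p1 cspan_expi_subspace (cmeasurableZ b (mq l')) (cmeasurableZ (- b) (mq l))
    (Lp_nearZ p1 cspan_expi_subspace b (mq l') (hq l' Sl'))
    (Lp_nearZ p1 cspan_expi_subspace (- b) (mq l) (hq l Sl)).
  by rewrite !mulr0 addr0.
pose c : R[i] := real_complex _ (2 * h).
have nc : normc c = 2 * h by rewrite normc_real gtr0_norm// mulr_gt0.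
apply: (@le_lt_trans _ _ (cLnorm mu p
    (fun x => c * (real_complex _ (y x) * (real_complex _ (y x) * q x))))).
  apply: le_cLnorm => //; last move=> x.
  - by apply: cmeasurableB; [exact: mqe|apply: cmeasurableD; apply: cmeasurableZ].
  - exact: cmeasurableZ.
  have -> : real_complex _ (y x) * q x * expi l x - g x = - (expi l x * (b * (q x *
      (cexp ('i%C * real_complex _ (h * y x)) - 1 - 'i%C * real_complex _ (h * y x))))).
    rewrite /g /l' expiD [expi (h *: _) x]/expi innerZl inner_delta -/(y x).
    have -> : real_complex _ (y x) = b * ('i%C * real_complex _ (h * y x)).
      by rewrite /b rmorphM [X in _ * X]mulrA mulKf.
    by ring.
  rewrite normcN normc_expiM !Normc.normcM nc !normc_real.
  have nb : normc b = h^-1.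
    by rewrite Normc.normcV Normc.normcM normc_i mul1r normc_real gtr0_norm.
  rewrite nb.
  apply: (@le_trans _ _ (h^-1 * (normc (q x) * (2 * `|h * y x| ^+ 2)))).
    rewrite ler_wpM2l ?invr_ge0 ?(ltW h0)// ler_wpM2l ?normc_ge0//.
    exact: normc_cexp_sub2.
  rewrite le_eqVlt; apply/orP; left; apply/eqP.
  by rewrite normrM (gtr0_norm h0); field; rewrite gt_eqF.
by by rewrite cLnormZ// -/N nc -(fineK Nfin) -EFinM lte_fin.
Qed.

End SomewhereDense.

(** * Density of polynomials and determinacy *)

Section Density.
Context {R : realType} {n : nat}.
Local Notation T := (borelRn R n).
Variables (mu : {measure set T -> \bar R}) (v : n.-tuple 'rV[R]_n).
Hypotheses (hmu : Mstar mu) (hv : basis_of fullv v).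
Hypothesis hm : forall j, moment_majorant mu (tnth v j).

Lemma Lp_near_all_expi (p : R) (V : set (T -> R[i])) (l0 : 'rV[R]_n) :
  1 <= p -> measurable_subspace V ->
  (forall k P, (0 < k)%N -> Lp_near mu k%:R V 0 (fun x => poly_fun P x * expi l0 x)) ->
  forall l, Lp_near mu p V 0 (expi l).
Proof.
move=> p1 hV h0 l.
(* Propagation is carried out in L_k for the integer k > p, and L_k approximation implies L_p
   approximation. *)
pose k := (Num.truncn p).+1.
have pk : p < k%:R by exact: truncnS_gt.
have p0 : 0 < p by exact: lt_le_trans p1.
have [ml _] := tempered_expi l.
apply: (Lp_near_comparison p0 pk (Mstar_finite hmu) hV ml).
have E : l = \sum_i coord v i (l - l0) *: tnth v i + l0.
  rewrite -[LHS](subrK l0); congr (_ + _).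
  rewrite {1}(coord_basis hv (memvf (l - l0))); apply: eq_bigr => i _.
  by rewrite (tnth_nth 0).
have := Lp_near_expi hmu (isT : (0 < k)%N) hV (index_enum 'I_n)
  (fun i => coord v i (l - l0)) hm (tempered_expi l0) (fun P => h0 k P isT) (mpoly.mpolyC n 1).
congr (Lp_near _ _ _ _ _); apply/funext => x.
by rewrite poly_funC mul1r -expiD -E.
Qed.

Lemma dense_in_Lp_expi (p : R) (V : set (T -> R[i])) : 1 <= p -> measurable_subspace V ->
  V `<=` tempered -> (forall l, Lp_near mu p V 0 (expi l)) -> dense_in_Lp mu p V.
Proof.
move=> p1 hV tV hE; have p0 : 0 < p by exact: lt_le_trans p1.
split; first by move=> f /tV tf; split; [case: tf|exact: tempered_Lp].
move=> f Lf e e0; have [mf _] := Lf.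
have {}hE g : cspan (@expi R n @` setT) g -> Lp_near mu p V 0 g.
  move=> [k [c [u [hu ->]]]].
  have mu_ i : cmeasurable (u i) by have [l _ <-] := hu i; have [] := tempered_expi l.
  have := @Lp_near_sum _ _ _ mu p V p1 hV k (fun i x => c i * u i x) (fun=> 0)
    (fun i => cmeasurableZ (c i) (mu_ i)).
  rewrite big1//; apply => i.
  have [l _ ul] := hu i; have [ml _] := tempered_expi l.
  by have := Lp_nearZ p1 hV (c i) ml (hE l); rewrite mulr0 ul.
have [g Vg] := Lp_near_trans p1 hV (trig_subspace (R := R) (n := n)) mf hE
  (Lp_near_trig (Mstar_finite hmu) p1 Lf) e0.
by rewrite add0r; exists g.
Qed.

Lemma dense_in_Lp_poly (p : R) : 1 <= p -> dense_in_Lp mu p (range (@poly_fun R n)).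
Proof.
move=> p1; apply: dense_in_Lp_expi => //; first exact: poly_subspace.
  by move=> _ [P _ <-]; exact: tempered_poly_fun.
apply: (@Lp_near_all_expi p _ 0 p1 poly_subspace) => k P k0.
have -> : (fun x => poly_fun P x * expi 0 x) = @poly_fun R n P.
  by apply/funext => x; rewrite expi0 mulr1.
by apply: Lp_near_subspace; [rewrite ler1n|exists P].
Qed.

Lemma dense_in_Lp_somewhere_dense (p : R) (S : set 'rV[R]_n) : 1 <= p ->
  somewhere_dense S -> dense_in_Lp mu p (cspan (@expi R n @` S)).
Proof.
move=> p1 [l0 Sl0]; apply: dense_in_Lp_expi => //; first exact: cspan_expi_subspace.
  apply: cspan_ind; first exact: tempered_cst.
    exact: temperedD.
  by move=> a _ [l _ <-]; apply: temperedM; [exact: tempered_cst|exact: tempered_expi].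
apply: (@Lp_near_all_expi p _ l0 p1 (@cspan_expi_subspace _ _ S)) => k P k0.
by apply: Lp_near_poly_expi; rewrite ?ler1n.
Qed.

End Density.

(** * Determinacy *)

Section Determinacy.
Context {R : realType} {n : nat}.
Local Notation T := (borelRn R n).
Implicit Types (mu nu : {measure set T -> \bar R}).

Lemma tempered_Re (f : T -> R[i]) : tempered f ->
  tempered (fun x => real_complex _ (complex.Re (f x))).
Proof.
move=> [[mre _] [C C0 [k hf]]]; split; first exact: cmeasurable_real.
exists C => //; exists k => x; rewrite normc_real.
exact: (le_trans (Re_le_normc _)).
Qed.

Lemma moment_eq mu nu v k :
  (forall P, cintegral nu (poly_fun P) = cintegral mu (poly_fun P)) ->
  moment nu v k = moment mu v k.
Proof.
move=> h; have [P hP] := poly_inner_pow (R := R) v k.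
have := congr1 (@complex.Re R) (h P); rewrite /cintegral hP /=.
by under eq_Rintegral do rewrite -rmorphXn/=; under [RHS]eq_Rintegral do rewrite -rmorphXn/=.
Qed.

Lemma moment_majorant_add mu nu v : Mstar mu -> Mstar nu ->
  (forall k, moment nu v k = moment mu v k) ->
  moment_majorant mu v -> moment_majorant (measure_add mu nu) v.
Proof.
move=> hmu hnu hk [m [C [m0 mnd mdiv C0 hm]]].
exists m, (C + C); split => //; first exact: addr_ge0.
move=> k; rewrite ge0_integral_measure_add//; last 2 first.
- by move=> x _; rewrite lee_fin exprM exprn_ge0// sqr_ge0.
- by apply/measurable_EFinP; apply: measurable_funX; exact: measurable_inner.
have := hm k; rewrite !integral_moment// hk => h.
by rewrite mulrDl EFinD leeD.
Qed.

Lemma Mstar_add mu nu : Mstar mu -> Mstar nu -> Mstar (measure_add mu nu).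
Proof.
move=> hmu hnu d d0; rewrite ge0_integral_measure_add//; last 2 first.
- by move=> x _; rewrite lee_fin powR_ge0.
- apply/measurable_EFinP; apply: (@measurableT_comp _ _ _ _ _ _ (@powR R ^~ d)) => //.
  exact: measurable_enorm.
by apply: lte_add_pinfty; [exact: hmu|exact: hnu].
Qed.

(** mu A is real, so it is compared with the real part of the integral of P; this lets one complex
    polynomial serve both measures. *)
Lemma measure_poly_dist mu (A : set T) P : Mstar mu -> measurable A ->
  (`|fine (mu A) - complex.Re (cintegral mu (poly_fun P))|%:E <=
    \int[mu]_x (normc (real_complex _ (\1_A x) - poly_fun P x)%R)%:E)%E.
Proof.
move=> hmu mA.
have tA : tempered (fun x : T => real_complex _ (\1_A x : R)).
  apply: tempered_bounded; first by apply: cmeasurable_real; exact: measurable_indic.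
  by move=> x; rewrite normc_real indicE; case: (_ \in _); rewrite /= ?normr1 ?normr0.
have tP := tempered_Re (tempered_poly_fun (R := R) P).
have iA := tempered_integrable hmu tA; have iP := tempered_integrable hmu tP.
have -> : fine (mu A) = \int[mu]_x (\1_A x).
  by rewrite /Rintegral integral_indic// setIT.
rewrite /cintegral /= -RintegralB// EFin_normr_Rintegral//; last first.
  by have := integrableB measurableT iA iP.
apply: (le_trans (le_abse_integral _ measurableT _)).
  by apply/measurable_EFinP; apply: measurable_funB; [have [[]] := tA|have [[]] := tP].
have [mA' _] := tA; have [mP' _] := tempered_poly_fun (R := R) P.
apply: ge0_le_integral => //.
- apply: measurableT_comp => //; apply/measurable_EFinP; apply: measurable_funB.
    by have [[]] := tA.
  by have [[]] := tP.
- by apply/measurable_EFinP; exact: (measurable_normc (cmeasurableB mA' mP')).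
move=> x _; rewrite abse_EFin lee_fin.
have := Re_le_normc (real_complex _ (\1_A x) - poly_fun P x).
by rewrite raddfB.
Qed.

Lemma determinate_of_majorant mu (v : n.-tuple 'rV[R]_n) : Mstar mu ->
  basis_of fullv v -> (forall j, moment_majorant mu (tnth v j)) -> determinate mu.
Proof.
move=> hmu hv hm; split => // nu hnu hP A mA.
have hadd := Mstar_add hmu hnu.
have [_ hd] := dense_in_Lp_poly hadd hv
  (fun j => moment_majorant_add hmu hnu (fun k => moment_eq (tnth v j) k hP) (hm j)) (lexx 1).
have tA : tempered (fun x : T => real_complex _ (\1_A x : R)).
  apply: tempered_bounded; first by apply: cmeasurable_real; exact: measurable_indic.
  by move=> x; rewrite normc_real indicE; case: (_ \in _); rewrite /= ?normr1 ?normr0.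
have LA : Lp (measure_add mu nu) 1 (fun x => real_complex _ (\1_A x : R)).
  by split; [case: tA|exact: tempered_Lp].
have fin m : Mstar m -> m A \is a fin_num.
  move=> /Mstar_finite mT; rewrite ge0_fin_numE// (le_lt_trans _ mT)//.
  by apply: le_measure; rewrite ?inE//; exact: subsetT.
rewrite -(fineK (fin _ hmu)) -(fineK (fin _ hnu)); congr EFin.
apply/eqP; rewrite -subr_eq0 -normr_le0; apply/ler_addgt0Pl => e e0; rewrite addr0.
have [_ [P _ <-] hPe] := hd _ LA e e0.
have mAP : cmeasurable (fun x : T => real_complex _ (\1_A x : R) - poly_fun P x).
  by apply: cmeasurableB; [case: tA|case: (tempered_poly_fun (R := R) P)].
move: hPe; rewrite cLnormE invr1 poweRe1; last first.
  by apply: integral_ge0 => x _; rewrite lee_fin powR_ge0.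
under eq_integral do rewrite powRr1 ?normc_ge0//.
rewrite ge0_integral_measure_add//; last 2 first.
- by move=> x _; rewrite lee_fin normc_ge0.
- by apply/measurable_EFinP; exact: measurable_normc.
(* The L_1 norm for mu + nu is the sum of the two norms, and P has the same integral for both
   measures, so the triangle inequality through this integral gives e. *)
have h1 := measure_poly_dist P hmu mA; have := measure_poly_dist P hnu mA.
rewrite hP => h2 h3; have := le_lt_trans (leeD h1 h2) h3.
rewrite -EFinD lte_fin => h4; apply: ltW; apply: le_lt_trans h4.
set a := fine (nu A); set b := complex.Re _; set c := fine (mu A).
rewrite (_ : a - c = (a - b) - (c - b)); last by ring.
by rewrite (le_trans (ler_normB _ _))// addrC.
Qed.

End Determinacy.

Theorem theorem2p3 (R : realType) (n : nat)
    (mu : {measure set (borelRn R n) -> \bar R})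
    (v : n.-tuple 'rV[R]_n)
    (hmu : Mstar mu)
    (hv : basis_of fullv v)
    (hcarleman : forall j : 'I_n, carleman (moment mu (tnth v j))) :
  determinate mu /\
  (forall p : R, 1 <= p ->
    dense_in_Lp mu p (range (@poly_fun R n)) /\
    (forall S : set 'rV[R]_n, somewhere_dense S ->
      dense_in_Lp mu p (cspan (@expi R n @` S)))).
Proof.
have hm j := carleman_moment_majorant hmu (hcarleman j).
split; first exact: (determinate_of_majorant hmu hv hm).
move=> p p1; split; first exact: (dense_in_Lp_poly hmu hv hm p1).
by move=> S hS; exact: (dense_in_Lp_somewhere_dense hmu hv hm p1 hS).
Qed.
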